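(* Let $R$ be an integral domain which is not a field and such that $R/(m)$ is finite for every $m\in R\setminus\{0\}$. Then the C*-algebra $\mathfrak{A}[R]$ is simple and purely infinite, i.e. for all $0\neq x\in\mathfrak{A}[R]$ there are $a,b\in\mathfrak{A}[R]$ with $axb=1$.
   Context: Integral domains are commutative with unit. Write $R^\times=R\setminus\{0\}$ and let $(m)$ be the ideal generated by $m$. $\mathfrak{A}[R]$ is the universal C*-algebra generated by isometries $\{s_m: m\in R^\times\}$ and unitaries $\{u^n: n\in R\}$ with the relations, for all $k,m\in R^\times$ and $l,n\in R$: (i) $s_ks_m=s_{km}$; (ii) $u^lu^n=u^{l+n}$; (iii) $s_mu^n=u^{mn}s_m$; (iv) $\sum_{n+(m)\in R/(m)}u^ne_mu^{-n}=1$, where $e_m=s_ms_m^*$ (the summand $u^ne_mu^{-n}$ depends only on the coset $n+(m)$). Here $u^n$ is the generator indexed by $n\in R$, and $u^{-n}=(u^n)^*$. *)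

(* Defs.v *)
From HB Require Import structures.
From mathcomp Require Export all_boot all_order all_algebra.
From mathcomp Require Export all_classical all_reals all_analysis.
From mathcomp Require Export complex.

Set Implicit Arguments.
Unset Strict Implicit.
Unset Printing Implicit Defensive.

Import Order.TTheory GRing.Theory Num.Theory.
Import numFieldNormedType.Exports.

Local Open Scope classical_set_scope.
Local Open Scope ring_scope.
Local Open Scope complex_scope.

(* Unital C*-algebras over the complex numbers: a Banach space over R[i] with a
   product, a unit and an involution.  This is a record rather than a structure of
   the hierarchy: numDomainType inherits from both rings and normed groups, so
   the hierarchy accepts no later join of these two.  The unit
   may be 0, so that the zero algebra is a unital C*-algebra.  As in any
   normedModType over R[i], norms are elements of R[i]. *)
Record cstarAlgType (R : realType) := CStarAlgType {
  cstar_space : completeNormedModType R[i];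
  cstar_one : cstar_space;
  cstar_mul : cstar_space -> cstar_space -> cstar_space;
  cstar_star : cstar_space -> cstar_space;
  cstar_mulA : associative cstar_mul;
  cstar_mul1l : left_id cstar_one cstar_mul;
  cstar_mul1r : right_id cstar_one cstar_mul;
  cstar_mulDl : left_distributive cstar_mul +%R;
  cstar_mulDr : right_distributive cstar_mul +%R;
  cstar_scaleAl : forall (a : R[i]) (x y : cstar_space),
    a *: cstar_mul x y = cstar_mul (a *: x) y;
  cstar_scaleAr : forall (a : R[i]) (x y : cstar_space),
    a *: cstar_mul x y = cstar_mul x (a *: y);
  cstar_starK : involutive cstar_star;
  cstar_starD : {morph cstar_star : x y / x + y};
  cstar_starZ : forall (a : R[i]) (x : cstar_space),
    cstar_star (a *: x) = Num.conj a *: cstar_star x;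
  cstar_starM : forall x y : cstar_space,
    cstar_star (cstar_mul x y) = cstar_mul (cstar_star y) (cstar_star x);
  cstar_normM : forall x y : cstar_space,
    `|cstar_mul x y| <= `|x| * `|y|;
  cstar_identity : forall x : cstar_space,
    `|cstar_mul (cstar_star x) x| = `|x| ^+ 2
}.

Definition cstar_sort (R : realType) (A : cstarAlgType R) : Type :=
  cstar_space A.
Coercion cstar_sort : cstarAlgType >-> Sortclass.

HB.instance Definition _ (R : realType) (A : cstarAlgType R) :=
  CompleteNormedModule.copy (cstar_sort A) (cstar_space A).

HB.instance Definition _ (R : realType) (A : cstarAlgType R) :=
  GRing.Zmodule_isPzRing.Build (cstar_sort A)
    (@cstar_mulA R A) (@cstar_mul1l R A) (@cstar_mul1r R A)
    (@cstar_mulDl R A) (@cstar_mulDr R A).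

Definition star (R : realType) (A : cstarAlgType R) : A -> A :=
  @cstar_star R A.

Section CStarTheory.
Variables (R : realType) (A : cstarAlgType R).
Implicit Types (a : R[i]) (x y : A).

Lemma calg_scalerAl a x y : a *: (x * y) = (a *: x) * y.
Proof. exact: cstar_scaleAl. Qed.

Lemma calg_scalerAr a x y : a *: (x * y) = x * (a *: y).
Proof. exact: cstar_scaleAr. Qed.

Lemma starK : involutive (@star R A).
Proof. exact: cstar_starK. Qed.

Lemma starD x y : star (x + y) = star x + star y.
Proof. exact: cstar_starD. Qed.

Lemma starZ a x : star (a *: x) = Num.conj a *: star x.
Proof. exact: cstar_starZ. Qed.

Lemma starM x y : star (x * y) = star y * star x.
Proof. exact: cstar_starM. Qed.

Lemma calg_normM x y : `|x * y| <= `|x| * `|y|.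
Proof. exact: cstar_normM. Qed.

Lemma calg_norm_starM x : `|star x * x| = `|x| ^+ 2.
Proof. exact: cstar_identity. Qed.

End CStarTheory.

Definition is_star_hom (R : realType) (A B : cstarAlgType R) (f : A -> B) :=
  [/\ {morph f : x y / x + y},
      forall (a : R[i]) (x : A), f (a *: x) = a *: f x,
      {morph f : x y / x * y},
      f 1 = 1 &
      {morph f : x / star x}].

Section RingCStarAlgebra.
Variables (R : realType) (D : idomainType).

Definition principal_ideal (m : D) : set D := [set m * r | r in [set: D]].

Definition coset_ideal (m n : D) : set D :=
  [set n + x | x in principal_ideal m].

Definition residue_classes (m : D) : set (set D) :=
  [set coset_ideal m n | n in [set: D]].

Definition range_proj (A : cstarAlgType R) (s : D -> A) (m : D) : A :=
  s m * star (s m).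

(* The generators s_m are indexed by nonzero m only: the value [s 0] is never
   constrained and never used.  In the last relation [xget 0 c] picks a
   representative of the coset c; the sum is the library's sum over a set,
   which is the actual sum because the set of residue classes is finite in the
   situation considered (it would be 0 on an infinite support). *)
Record ring_cstar_relations (A : cstarAlgType R) (s u : D -> A) : Prop := {
  s_isometry : forall m : D, m != 0 -> star (s m) * s m = 1;
  u_unitaryl : forall n : D, star (u n) * u n = 1;
  u_unitaryr : forall n : D, u n * star (u n) = 1;
  s_mul : forall k m : D, k != 0 -> m != 0 -> s k * s m = s (k * m);
  u_add : forall l n : D, u l * u n = u (l + n);
  s_u_comm : forall m n : D, m != 0 -> s m * u n = u (m * n) * s m;
  sum_range_proj : forall m : D, m != 0 ->
    \sum_(c \in residue_classes m)
       (u (xget 0 c) * range_proj s m * star (u (xget 0 c))) = 1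
}.

Definition maps_generators (A B : cstarAlgType R)
    (s u : D -> A) (s' u' : D -> B) (f : A -> B) : Prop :=
  [/\ is_star_hom f,
      forall m : D, m != 0 -> f (s m) = s' m &
      forall n : D, f (u n) = u' n].

(* (A, s, u) is the universal C*-algebra with the above generators and
   relations, which determines it up to a unique isomorphism. *)
Definition is_universal_ring_cstar (A : cstarAlgType R) (s u : D -> A) : Prop :=
  ring_cstar_relations s u /\
  forall (B : cstarAlgType R) (s' u' : D -> B),
    ring_cstar_relations s' u' ->
    exists2 f : A -> B, maps_generators s u s' u' f &
      forall g : A -> B, maps_generators s u s' u' g -> g =1 f.

End RingCStarAlgebra.

Definition is_closed_ideal (R : realType) (A : cstarAlgType R) (J : set A) :=
  [/\ closed J, J 0,
      forall x y, J x -> J y -> J (x + y),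
      forall (a : R[i]) x, J x -> J (a *: x) &
      forall x y, J y -> J (x * y) /\ J (y * x)].

Definition is_simple (R : realType) (A : cstarAlgType R) : Prop :=
  (1 : A) != 0 /\
  forall J : set A, is_closed_ideal J -> J = [set 0] \/ J = [set: A].

Definition is_simple_purely_infinite (R : realType) (A : cstarAlgType R) : Prop :=
  is_simple A /\ forall x : A, x != 0 -> exists a b : A, a * x * b = 1.

(* Main.v *)
From HB Require Import structures.
Require Import Defs.
From mathcomp Require Import finmap ring lra.
Import Order.TTheory GRing.Theory Num.Theory.
Import numFieldNormedType.Exports.
Set Implicit Arguments.
Unset Strict Implicit.
Unset Printing Implicit Defensive.
Local Open Scope classical_set_scope.
Local Open Scope ring_scope.
Local Open Scope complex_scope.

(** Write v(a, m) = u^a s_m for a pair (a, m) with m <> 0.  These are isometries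
    with v(a, m) v(b, k) = v(a + m b, m k), and v(a, m)^* v(b, m) = 0 unless a and b
    are congruent modulo m.  The core of the proof is that for every x <> 0 there
    are a and b with a x b = 1; an ideal containing x then contains 1, so simplicity
    follows once 1 <> 0 is known.

    It is enough to find an isometry W and a scalar lambda > 0, comparable to the
    squared norm of x, with W^* x^* x W close to lambda 1, for then a Neumann series
    inverts W^* x^* x W ([left_inverse_near1], [approximable_invertible]).  By
    universality the algebra is the closure of the *-algebra spanned by the products
    of generators and their adjoints ([universal_generated]), so that x may be
    replaced by an element y of the latter.  Such a y is a finite sum of terms
    c v(p) v(b, M)^* with one common M ([locally_mono_normal_form]), and for it
    [exists_compressing_isometry] gives W with (y W)^* (y W) exactly equal to a
    scalar lambda 1 and |y|^2 <= 4 lambda.  There are two ingredients.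

    Scalars: for finitely many distinct pairs p there is one pair r such that the
    isometries v(p) v(r) have orthogonal ranges ([exists_separating_mono]), because D
    is infinite and has nonzero nonunits.  If W = sum_i z_i v(p_i) v(r), then y W is a
    combination of such isometries as well, and both squares are scalars.

    Norm: y maps the span of the v(p), p in a finite set F, into that of the v(q) by a
    complex matrix T, and also v(q)^* y is a combination of the v(p)^* for the q in
    some set F'.  The pairs form a semigroup of affine maps, which is amenable;
    concretely, F and F' can be chosen as boxes whose range projections add up to N
    and N' with N <= 4 N' ([exists_folner_boxes]).  Diagonalising T^* T turns this
    into N' |y|^2 <= N |T z|^2 for a unit vector z ([norm_le_matrix]).  Sums of
    squares control norms: if the z_i^* z_i add up to mu, then stacking the z_i along
    orthogonal isometries gives a multiple of an isometry with the z_i as compressions,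
    whence |z_i|^2 <= mu ([norm_entry_le]).

    Orthogonality of the ranges of the v(n, m) for distinct residues n is hidden in the
    relation that their range projections have sum 1.  It holds in all C*-algebras
    ([proj_sum1_orth]); the proof given here relies on the fact that the unit of the
    corner pAp is a vertex of its unit ball.

    Finally 1 <> 0: the bounded matrices indexed by D form a C*-algebra
    ([matrix_cstar]) in which translations and dilations of D satisfy the relations
    ([model_relations]), and the universal algebra maps to it. *)

(** * Norms in C*-algebras *)

Lemma ge0_complexP (R : realType) (a : R[i]) : 0 <= a ->
  exists2 r : R, 0 <= r & a = r%:C.
Proof. by case: a => x y; rewrite lecE /= => /andP[/eqP -> x0]; exists x. Qed.

Section Basics.
Variables (R : realType) (A : cstarAlgType R).
Implicit Types (x y z p q f v : A) (a : R[i]).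

Lemma star0 : star (0 : A) = 0.
Proof. by apply: (addrI (star (0 : A))); rewrite -starD !addr0. Qed.

Lemma starN x : star (- x) = - star x.
Proof. by apply: (addrI (star x)); rewrite -starD !subrr star0. Qed.

Lemma starB x y : star (x - y) = star x - star y.
Proof. by rewrite starD starN. Qed.

Lemma star1 : star (1 : A) = 1.
Proof.
by have := starM (star (1 : A)) 1; rewrite mulr1 !starK mulr1 => <-.
Qed.

Lemma star_sum (I : Type) (s : seq I) (P : pred I) (F : I -> A) :
  star (\sum_(i <- s | P i) F i) = \sum_(i <- s | P i) star (F i).
Proof. exact: (big_morph _ (@starD _ _) star0). Qed.

Lemma norm_star x : `|star x| = `|x|.
Proof.
suff le_star y : `|y| <= `|star y|.
  by apply/le_anti; rewrite le_star -{2}[x]starK le_star.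
have [->|y0] := eqVneq y 0; first by rewrite star0.
rewrite -(ler_pM2r (_ : 0 < `|y|)) ?normr_gt0 // -expr2 -calg_norm_starM.
exact: calg_normM.
Qed.

Lemma mul_scalel a x y : (a *: x) * y = a *: (x * y).
Proof. by rewrite calg_scalerAl. Qed.

Lemma mul_scaler a x y : x * (a *: y) = a *: (x * y).
Proof. by rewrite calg_scalerAr. Qed.

Lemma norm_isometryM v x : star v * v = 1 -> `|v * x| = `|x|.
Proof.
move=> vv; apply/eqP; rewrite -(@eqrXn2 _ 2) ?normr_ge0 //.
by rewrite -!calg_norm_starM starM -mulrA (mulrA _ v) vv mul1r.
Qed.

Lemma norm_one_le1 : `|1 : A| <= 1.
Proof.
have [/eqP|n0] := eqVneq `|1 : A| 0; first by move/eqP => ->.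
rewrite -(ler_pM2r (_ : 0 < `|1 : A|)) ?lt_def ?n0 ?normr_ge0 // mul1r.
by rewrite -expr2 -calg_norm_starM star1 mul1r.
Qed.

Lemma norm_isometry v : star v * v = 1 -> `|v| <= 1.
Proof. by move=> vv; rewrite -[v]mulr1 norm_isometryM // norm_one_le1. Qed.

Lemma norm_proj p : star p = p -> p * p = p -> `|p| <= 1.
Proof.
move=> ps pp; have : `|p| = `|p| ^+ 2 by rewrite -calg_norm_starM ps pp.
have [->//|n0] := eqVneq `|p| 0.
by rewrite expr2 -{1}[ `|p|]mulr1 => /(mulfI n0) <-.
Qed.

Lemma starM_eq0 x : star x * x = 0 -> x = 0.
Proof.
move=> h; apply/eqP; rewrite -normr_eq0 -sqrf_eq0.
by rewrite -calg_norm_starM h normr0.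
Qed.

Lemma norm_mul_le1 x y : `|x| <= 1 -> `|y| <= 1 -> `|x * y| <= 1.
Proof.
by move=> hx hy; apply: le_trans (calg_normM _ _) _; apply: mulr_ile1.
Qed.

Lemma norm_half x : `|x + x| <= 2 -> `|x| <= 1.
Proof.
move=> h; rewrite -(ler_pM2l (_ : 0 < 2)) // mulr1; apply: le_trans h.
by rewrite -mulr2n normrMn mulr_natl.
Qed.

Lemma norm_mean x y z : x + y = z + z -> `|x| <= 1 -> `|y| <= 1 -> `|z| <= 1.
Proof.
move=> e hx hy; apply: norm_half; rewrite -e; apply: le_trans (ler_normD _ _) _.
by rewrite -[2]/(1 + 1) lerD.
Qed.

Lemma sum_two_squares (V : zmodType) (x g h q : V) :
  (x + g + (g + q)) + (x + h + (h - q)) = (x + (g + h)) + (x + (g + h)).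
Proof.
rewrite !addrA [LHS](ACl (1*2*6*5*3*7*(4*8)))/= subrr addr0.
by [].
Qed.

Lemma sum_opposite_squares (V : zmodType) (x f q : V) :
  (x + f + (f + q)) + (x - f + (- f + q)) = (x + q) + (x + q).
Proof.
by rewrite !addrA [LHS](ACl (1*4*5*8*((2*6)*(3*7))))/= !subrr !addr0.
Qed.

(** * Projections with sum 1 are orthogonal *)

Section Vertex.
Variables (p : A).
Hypothesis pp : p * p = p.

(** The four points p + i^k f around the unit p of a corner lie in the unit ball;
    this forces f = 0, since p is a vertex of the ball. *)
Definition around f := forall k : nat, `|p + 'i ^+ k *: f| <= 1.

(** With a = i^k, the mean of (p + a f)^2 = p + 2 a f + a^2 f^2 and
    (p + i a f)^2 = p + 2 i a f - a^2 f^2 is p + (1 + i) a f. *)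
Lemma around_step f :
  p * f = f -> f * p = f -> around f -> around ((1 + 'i) *: f).
Proof.
move=> pf fp h k; have := h k.+1; have := h k.
rewrite [_ *: (_ *: f)]scalerA mulrDr mulr1 scalerDl exprSr.
set a := 'i ^+ k; rewrite -[(a * 'i) *: f]scalerA => e e'.
apply: (norm_mean (x := (p + a *: f) * (p + a *: f))
  (y := (p + a *: ('i *: f)) * (p + a *: ('i *: f)))); last 2 first.
- exact: norm_mul_le1.
- exact: norm_mul_le1.
rewrite -(sum_two_squares _ _ _ (a *: f * (a *: f))).
have pf' b : p * (b *: f) = b *: f by rewrite mul_scaler pf.
have fp' b : (b *: f) * p = b *: f by rewrite mul_scalel fp.
congr (_ + _); rewrite mulrDl !mulrDr pp ?scalerA !pf' !fp' //.
congr (_ + (_ + _)); rewrite !mul_scalel !mul_scaler !scalerA -scaleNr.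
by rewrite mulrACA -expr2 -expr2 sqrCi mulrN1.
Qed.

(** Two steps multiply f by (1 + i)^2 = 2 i, hence up to a fourth root of unity by
    2, so that all 2^n f have norm at most 2. *)
Lemma around_eq0 f : p * f = f -> f * p = f -> around f -> f = 0.
Proof.
move=> pf fp h.
have h2 n : around (2 ^+ n *: f).
  elim: n => [|n IH]; first by rewrite expr0 scale1r.
  have pf' a : p * (a *: f) = a *: f by rewrite mul_scaler pf.
  have fp' a : (a *: f) * p = a *: f by rewrite mul_scalel fp.
  have := around_step (pf' _) (fp' _) IH; rewrite scalerA.
  move/(around_step (pf' _) (fp' _)); rewrite !scalerA mulrA -expr2.
  rewrite (_ : (1 + 'i) ^+ 2 = 2 * 'i); last first.
    by rewrite sqrrD sqrCi expr1n mul1r addrAC subrr add0r mulr_natl.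
  move=> h' k; have := h' (k + 3)%N.
  rewrite !scalerA exprD.
  rewrite (_ : 'i ^+ k * 'i ^+ 3 * (2 * 'i * 2 ^+ n) = 'i ^+ k * 2 ^+ n.+1) //.
  rewrite -mulrA [2 ^+ n.+1]exprS; congr (_ * _); rewrite [2 * 'i]mulrC !mulrA -exprSr.
  by rewrite (exprM 'i 2 2) sqrCi sqrrN expr1n mul1r.
have np : `|p| <= 1.
  have := h 0%N; have := h 2%N; rewrite sqrCi expr0 scaleN1r scale1r => e1 e2.
  by apply: (norm_mean (x := p - f) (y := p + f)); rewrite // addrACA addNr addr0.
apply/eqP; rewrite -normr_eq0; apply/negP => /negP f0.
have fpos : 0 < `|f| by rewrite lt_def f0 normr_ge0.
have bound n : 2 ^+ n * `|f| <= 2.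
  have -> : 2 ^+ n * `|f| = `|2 ^+ n *: f|.
    by rewrite normrZ normrX ger0_norm.
  rewrite -[_ *: f](addrK p); apply: le_trans (ler_normB _ _) _.
  rewrite -[leRHS]/(1 + 1); apply: lerD => //.
  by have := h2 n 0%N; rewrite expr0 scale1r addrC.
have [r _ fR] := ge0_complexP (normr_ge0 f).
move: fpos bound; rewrite fR ltcR => fpos bound.
have [n hn] : exists n : nat, 2 / r < n%:R.
  by exists (Num.trunc (2 / r)).+1; exact: truncnS_gt.
have := bound n; rewrite -[2](rmorph_nat (real_complex R)).
rewrite -rmorphXn -rmorphM lecR => hn'.
move: hn; rewrite ltr_pdivrMr // => hn.
have : n%:R * r <= 2 ^+ n * r.
  by rewrite ler_pM2r // -natrX ler_nat ltnW // ltn_expl.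
by move=> /le_trans /(_ hn') /(lt_le_trans hn); rewrite ltxx.
Qed.

(** The two real points suffice for self-adjoint f: the mean of the (p +- f)^2 is
    p + f^2, which is also (p +- i f)^* (p +- i f). *)
Lemma around_self_adjoint f : star p = p -> star f = f ->
  p * f = f -> f * p = f -> `|p + f| <= 1 -> `|p - f| <= 1 -> f = 0.
Proof.
move=> ps fs pf fp h1 h2; apply: around_eq0 => //.
have hi : `|p + f * f| <= 1.
  apply: (norm_mean (x := (p + f) * (p + f)) (y := (p - f) * (p - f)));
    rewrite ?norm_mul_le1 //.
  rewrite !mulrDl !mulrDr !mulrN !mulNr pp pf fp opprK.
  exact: sum_opposite_squares.
have hsq (a : R[i]) : a * Num.conj a = 1 -> Num.conj a = - a ->
    `|p + a *: f| <= 1.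
  move=> aa ca; rewrite -(@ler_sqr _ _ 1) ?nnegrE ?normr_ge0 // expr1n.
  rewrite -calg_norm_starM starD starZ ps fs ca scaleNr.
  rewrite mulrDl !mulrDr !mulNr !mul_scalel !mul_scaler pp pf fp scalerA.
  by rewrite addrA addrK -scaleNr -mulrN -ca aa scale1r.
move=> k; rewrite (divn_eq k 4) addnC exprD mulnC exprM.
rewrite (exprM 'i 2 2) sqrCi sqrrN expr1n expr1n mulr1.
have : (k %% 4 < 4)%N by rewrite ltn_mod.
case: (k %% 4)%N => [|[|[|[|//]]]] _.
- by rewrite expr0 scale1r.
- by apply: hsq; rewrite ?conjCi ?mulrN -?expr2 ?sqrCi ?opprK.
- by rewrite sqrCi scaleN1r.
- rewrite exprS sqrCi mulrN1; apply: hsq; rewrite ?rmorphN /= ?conjCi //.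
  by rewrite opprK mulNr -expr2 sqrCi opprK.
Qed.

End Vertex.

Lemma norm_reflection q : star q = q -> q * q = q -> `|1 - (q + q)| <= 1.
Proof.
move=> qs qq; apply: norm_isometry; rewrite starB star1 starD qs.
rewrite mulrBl mul1r mulrBr mulr1 mulrDl mulrDr !qq; set r := q + q.
by rewrite opprB addrK subrK.
Qed.

(** Put p = q_i and d = p q_j p.  The L remaining projections q_k satisfy
    sum_k p q_k p = - d.  As |1 - 2 q| <= 1 for a projection q, both
    p + sum_k p (1 - 2 q_k) p = (L + 1) p + 2 d and
    L p + p (1 - 2 q_j) p = (L + 1) p - 2 d have norm at most L + 1.  Since p is a
    vertex, d = (q_j p)^* (q_j p) vanishes. *)
Lemma proj_sum1_orth (I : eqType) (s : seq I) (q : I -> A) i j : uniq s ->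
  (forall k, k \in s -> star (q k) = q k) ->
  (forall k, k \in s -> q k * q k = q k) ->
  \sum_(k <- s) q k = 1 -> i \in s -> j \in s -> i != j -> q j * q i = 0.
Proof.
move=> us qs qq q1 si sj ij.
set p := q i; set d := p * q j * p.
have [ps pp] : star p = p /\ p * p = p by rewrite qs // qq.
set rest := rem j (rem i s); set T := \sum_(k <- rest) q k.
have sub k : k \in rest -> k \in s by move/mem_rem/mem_rem.
have j_rem : j \in rem i s by rewrite mem_rem_uniq // inE eq_sym ij.
have pTp : p * T * p = - d.
  have : p * (\sum_(k <- s) q k) * p = p by rewrite q1 mulr1.
  rewrite (perm_big _ (perm_to_rem si)) big_cons.
  rewrite (perm_big _ (perm_to_rem j_rem)) big_cons -/T !mulrDr !mulrDl -/p.
  rewrite !pp -[RHS]addr0 -/d => /addrI; rewrite addrC => /eqP.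
  by rewrite addr_eq0 => /eqP.
have conj_le x : `|x| <= 1 -> `|p * x * p| <= 1.
  by move=> h; rewrite norm_mul_le1 ?norm_mul_le1 // norm_proj.
set L := size rest; pose K : R[i] := L.+1%:R.
have K0 : 0 < K by rewrite ltr0n.
have KK : K \is a GRing.unit by rewrite unitfE gt_eqF.
have scale_le x y : K *: x = y -> `|y| <= K -> `|x| <= 1.
  move=> <-; rewrite normrZ gtr0_norm // -{2}[K]mulr1.
  by rewrite ler_pM2l.
pose f := K^-1 *: (d + d).
have Kf : K *: f = d + d by rewrite scalerA divrr // scale1r.
have ds : star d = d by rewrite !starM ps qs // mulrA.
have pd : p * d = d by rewrite /d !mulrA pp.
have dp : d * p = d by rewrite /d -!mulrA pp.
have f0 : f = 0.
  apply: (around_self_adjoint pp) => //.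
  - by rewrite starZ starD ds conj_Creal // rpredV realn.
  - by rewrite mul_scaler mulrDr pd.
  - by rewrite mul_scalel mulrDl dp.
  - apply: (scale_le _ (p + \sum_(k <- rest) (p * (1 - (q k + q k)) * p))).
      rewrite -mulr_suml -mulr_sumr sumrB big_split /= -/T scalerDr Kf.
      rewrite big_const_seq count_predT iter_addr_0 -/L.
      rewrite mulrBr mulrBl mulrDr mulrDl pTp opprD !opprK mulr_natr mulrnAl pp.
      by rewrite -scaler_nat /K -add1n natrD scalerDl scale1r !addrA.
    apply: le_trans (ler_normD _ _) _; rewrite /K mulrS lerD ?norm_proj //.
    apply: le_trans (ler_norm_sum _ _ _) _.
    rewrite /L -sum1_size natr_sum; rewrite !big_seq; apply: ler_sum => k ks.
    by apply: conj_le; apply: norm_reflection; rewrite ?qs ?qq ?sub.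
  - apply: (scale_le _ (L%:R *: p + p * (1 - (q j + q j)) * p)).
      rewrite mulrBr mulrBl mulrDr mulrDl -/d mulr1 pp scalerBr Kf addrA.
      by rewrite /K -addn1 natrD scalerDl scale1r.
    apply: le_trans (ler_normD _ _) _; rewrite /K -addn1 natrD lerD //.
      by rewrite normrZ normr_nat ler_piMr // norm_proj.
    by apply: conj_le; apply: norm_reflection; rewrite ?qs ?qq.
have d0 : d = 0.
  have : d + d = 0 by rewrite -Kf f0 scaler0.
  rewrite -mulr2n -scaler_nat => /eqP; rewrite scaler_eq0 pnatr_eq0 /=.
  by move/eqP.
by apply: starM_eq0; rewrite starM ps qs // mulrA -[p * _ * _]mulrA qq.
Qed.
End Basics.

(** * Residue classes and arithmetic of the domain *)

Section Residues.
Variable D : idomainType.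
Hypothesis D_finite_quotients :
  forall m : D, m != 0 -> finite_set (residue_classes m).

Definition reps (m : D) : seq D :=
  [seq xget 0 c | c <- fset_set (residue_classes m)].

Lemma coset_repr (m n : D) : exists z, xget 0 (coset_ideal m n) = n + m * z.
Proof.
have : coset_ideal m n (xget 0 (coset_ideal m n)).
  apply: (@xgetPex _ 0 (coset_ideal m n)); exists n => //.
  by exists 0; rewrite ?addr0 //; exists 0; rewrite ?mulr0.
by case=> x [z _ <-] <-; exists z.
Qed.

Lemma coset_eq (m n z : D) : coset_ideal m (n + m * z) = coset_ideal m n.
Proof.
apply/seteqP; split=> x [y [r _ <-] <-].
  by exists (m * (z + r)); [exists (z + r)|rewrite mulrDr addrA].
by exists (m * (r - z)); [exists (r - z)|rewrite mulrBr -addrA subrKC].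
Qed.

Lemma reps_exists m n : m != 0 -> exists2 r, r \in reps m & exists z, n = r + m * z.
Proof.
move=> m0; have [z ez] := coset_repr m n.
exists (xget 0 (coset_ideal m n)).
  apply: map_f; rewrite in_fset_set; last exact: D_finite_quotients.
  by apply: mem_set; exists n.
by exists (- z); rewrite ez mulrN addrK.
Qed.

Lemma reps_congr m r r' z : m != 0 -> r \in reps m -> r' \in reps m ->
  r = r' + m * z -> r = r'.
Proof.
move=> m0 /mapP[c hc ->] /mapP[c' hc' ->] e.
move: hc hc'; rewrite !in_fset_set; try exact: D_finite_quotients.
move=> /set_mem[n _ en] /set_mem[n' _ en']; move: e; rewrite -en -en'.
have [y ey] := coset_repr m n; have [y' ey'] := coset_repr m n'.
move=> e; congr (xget _ _); rewrite ey ey' in e.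
by rewrite -[LHS](coset_eq m n y) e -addrA -mulrDr coset_eq.
Qed.

Lemma reps_uniq m : m != 0 -> uniq (reps m).
Proof.
move=> m0; rewrite map_inj_in_uniq ?fset_uniq // => c c'.
rewrite !in_fset_set; try exact: D_finite_quotients.
move=> /set_mem[n _ <-] /set_mem[n' _ <-].
have [y ->] := coset_repr m n; have [y' ->] := coset_repr m n'.
by move=> e; rewrite -(coset_eq m n y) e coset_eq.
Qed.

End Residues.

Section Arithmetic.
Variable D : idomainType.
Hypothesis D_not_field : ~ GRing.field_axiom D.

Lemma exists_nonunit : exists2 t : D, t != 0 & t \isn't a GRing.unit.
Proof.
apply: contrapT => h; apply: D_not_field => x x0; apply: contrapT => /negP ux.
by apply: h; exists x.
Qed.

(** The powers of a nonzero nonunit are distinct. *)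
Lemma exists_injective_seq : exists f : nat -> D, injective f.
Proof.
have [t t0 tu] := exists_nonunit; exists (GRing.exp t).
suff lt_neq i j : (i < j)%N -> t ^+ i <> t ^+ j.
  move=> i j e; case: (ltngtP i j) => // /lt_neq; first by move/(_ e).
  by move/(_ (esym e)).
move=> ij; rewrite -(subnKC ij) addSnnS exprD -{1}[t ^+ i]mulr1.
move/(mulfI (expf_neq0 _ t0)); rewrite exprS => e.
by move/negP: tu; apply; apply/unitrP; exists (t ^+ (j - i.+1)); rewrite mulrC -e.
Qed.

(** Multiply the product of l by a nonunit t: if x in l were a multiple of the
    result, t would be invertible. *)
Lemma exists_nondivisor (l : seq D) : (forall x, x \in l -> x != 0) ->
  exists2 M : D, M != 0 & forall x z, x \in l -> x <> M * z.
Proof.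
have [t t0 tu] := exists_nonunit => l0; exists (t * \prod_(x <- l) x).
  rewrite mulf_neq0 //; apply/negP; rewrite prodf_seq_eq0 => /hasP[x /l0].
  by move=> /negbTE /= ->.
move=> x z xl; rewrite (perm_big _ (perm_to_rem xl)) big_cons /=.
rewrite mulrCA -mulrA -{1}[x]mulr1 => /(mulfI (l0 _ xl)) e.
move/negP: tu; apply; apply/unitrP; exists (\prod_(y <- rem x l) y * z).
by rewrite [_ * t]mulrC mulrA -e.
Qed.

Lemma exists_nonroot (p : {poly D}) : p != 0 -> exists x, p.[x] != 0.
Proof.
move=> p0; have [f fi] := exists_injective_seq.
apply: contrapT => h.
have hr x : root p x.
  by rewrite rootE; apply: contrapT => /negP hx; apply: h; exists x.
have rs_roots : all (root p) [seq f i | i <- iota 0 (size p)].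
  by apply/allP => x _; exact: hr.
have := max_poly_roots p0 rs_roots.
by rewrite map_inj_uniq ?iota_uniq // size_map size_iota ltnn => /(_ isT).
Qed.

(** Composition of the affine maps x -> p.1 + p.2 x. *)
Definition pmul (p q : D * D) : D * D := (p.1 + p.2 * q.1, p.2 * q.2).

(** Two distinct affine maps agree at one point at most, and D is infinite: take a
    nonroot of the product of all their differences, seen as polynomials. *)
Lemma exists_separating_point (F : seq (D * D)) : exists x : D,
  forall p q, p \in F -> q \in F -> p != q -> p.1 + p.2 * x != q.1 + q.2 * x.
Proof.
pose P (pq : (D * D) * (D * D)) : {poly D} :=
  if pq.1 == pq.2 then 1 else (pq.1.1 - pq.2.1)%:P + (pq.1.2 - pq.2.2) *: 'X.
have P0 pq : P pq != 0.
  rewrite /P; case: ifPn => [_|]; first exact: oner_neq0.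
  apply: contra => /eqP e; have := congr1 (fun p : {poly D} => p`_0) e.
  have := congr1 (fun p : {poly D} => p`_1) e.
  rewrite /= !coefD !coefC !coefZ !coefX ?coef0 /= mulr1 mulr0 addr0 add0r.
  move=> /eqP; rewrite subr_eq0 => /eqP h1 /eqP; rewrite subr_eq0 => /eqP h2.
  by move: h1 h2; case: pq {e} => [[? ?] [? ?]] /= -> ->.
have Q0 : \prod_(pq <- [seq (p, q) | p <- F, q <- F]) P pq != 0.
  by apply/negP; rewrite prodf_seq_eq0 => /hasP[pq _ /=]; rewrite (negbTE (P0 _)).
have [x hx] := exists_nonroot Q0; exists x => p q pF qF pq.
move: hx; rewrite horner_prod; apply: contraNneq => e.
rewrite prodf_seq_eq0.
apply/hasP; exists (p, q); first exact: allpairs_f.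
rewrite /= /P /= (negbTE pq) hornerD hornerC hornerZ hornerX mulrBl.
by rewrite addrACA -opprD e subrr.
Qed.
End Arithmetic.

(** * The isometries v(a, m) *)

Section Monomials.
Variables (R : realType) (D : idomainType).
Hypothesis D_not_field : ~ GRing.field_axiom D.
Hypothesis D_finite_quotients :
  forall m : D, m != 0 -> finite_set (residue_classes m).
Variables (A : cstarAlgType R) (s u : D -> A).
Hypothesis rel : ring_cstar_relations s u.

Definition mono (p : D * D) : A := u p.1 * s p.2.
Local Notation v := mono.

Lemma u0 : u 0 = 1.
Proof.
rewrite -[LHS]mul1r -{1}(u_unitaryl rel 0) -mulrA (u_add rel) addr0.
exact: (u_unitaryl rel).
Qed.

Lemma star_u n : star (u n) = u (- n).
Proof.
by rewrite -[LHS]mulr1 -u0 -(subrr n) -(u_add rel) mulrA (u_unitaryl rel) mul1r.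
Qed.

Lemma s1 : s 1 = 1.
Proof.
rewrite -[LHS]mul1r -(s_isometry rel (oner_neq0 D)) -mulrA (s_mul rel) ?oner_neq0 //.
by rewrite mulr1 (s_isometry rel) ?oner_neq0.
Qed.

Lemma mono_isometry p : p.2 != 0 -> star (v p) * v p = 1.
Proof.
move=> p0; rewrite starM -mulrA (mulrA _ (u _)) (u_unitaryl rel) mul1r.
exact: (s_isometry rel).
Qed.

Lemma monoM p q : p.2 != 0 -> q.2 != 0 -> v p * v q = v (pmul p q).
Proof.
move=> p0 q0; rewrite /mono /pmul /= -(u_add rel) -(s_mul rel) // -!mulrA.
by congr (_ * _); rewrite !mulrA (s_u_comm rel).
Qed.

Lemma mono_u a : v (a, 1) = u a.
Proof. by rewrite /mono s1 mulr1. Qed.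

Lemma sum_reps m : m != 0 ->
  \sum_(r <- reps m) v (r, m) * star (v (r, m)) = 1.
Proof.
move=> m0; rewrite -(sum_range_proj rel m0) fsbig_finite /=; last exact: D_finite_quotients.
rewrite big_map; apply: eq_bigr => c _.
by rewrite /mono /range_proj starM !mulrA.
Qed.

(** The ranges depend only on the residues of a and b, and distinct representatives
    have orthogonal ranges because all these projections add up to 1. *)
Lemma mono_orth m a b : m != 0 -> (forall z, a <> b + m * z) ->
  star (v (a, m)) * v (b, m) = 0.
Proof.
move=> m0 ab; have [ra ra_in [x ea]] := reps_exists D_finite_quotients a m0.
have [rb rb_in [y eb]] := reps_exists D_finite_quotients b m0.
have rab : ra != rb.
  apply/eqP => e; apply: (ab (x - y)).
  by rewrite ea eb e mulrBr -addrA [m * y + _]addrC subrK.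
have shift r z : v (r + m * z, m) = v (r, m) * u z.
  by rewrite /mono /= -(u_add rel) -!mulrA (s_u_comm rel).
rewrite ea eb !shift starM -mulrA (mulrA _ _ (u y)).
suff -> : star (v (ra, m)) * v (rb, m) = 0 by rewrite mul0r mulr0.
pose q r := v (r, m) * star (v (r, m)).
have qi r : q r * v (r, m) = v (r, m) by rewrite /q -mulrA mono_isometry ?mulr1.
have qs r : star (q r) = q r by rewrite /q starM starK.
rewrite -(qi ra) -(qi rb) starM qs -mulrA (mulrA _ (q rb)).
rewrite (proj_sum1_orth (s := reps m) (q := q)) ?reps_uniq ?sum_reps //.
- by rewrite mul0r mulr0.
- by move=> k _; rewrite {2}/q mulrA qi.
- by rewrite eq_sym.
Qed.

Lemma mono_orth_dvd t a b m k : t != 0 -> m != 0 -> k != 0 ->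
  (forall z, a <> b + t * z) -> star (v (a, t * m)) * v (b, t * k) = 0.
Proof.
move=> t0 m0 k0 ab.
have fact c l : l != 0 -> v (c, t * l) = v (c, t) * v (0, l).
  by move=> l0; rewrite monoM // /pmul /= mulr0 addr0.
by rewrite !fact // starM -mulrA (mulrA _ _ (v (0, k))) mono_orth // mul0r mulr0.
Qed.

(** Multiplying by v(x, M) turns v(a, m) into v(a + m x, M m).  If x separates the
    affine maps in F, it remains to choose M dividing none of the nonzero differences
    of the values a + m x. *)
Lemma exists_separating_mono (F : seq (D * D)) : (forall p, p \in F -> p.2 != 0) ->
  exists2 r : D * D, r.2 != 0 & forall p q, p \in F -> q \in F -> p != q ->
    star (v p * v r) * (v q * v r) = 0.
Proof.
move=> F0; have [x hx] := exists_separating_point D_not_field F.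
pose l := [seq d <- [seq (p.1 + p.2 * x) - (q.1 + q.2 * x) | p <- F, q <- F] | d != 0].
have l0 d : d \in l -> d != 0 by rewrite mem_filter => /andP[].
have [M M0 hM] := exists_nondivisor D_not_field l0.
exists (x, M) => // p q pF qF pq.
have vM p' : p' \in F -> v p' * v (x, M) = v (p'.1 + p'.2 * x, M * p'.2).
  by move=> pF'; rewrite (monoM (F0 _ pF') (M0 : (x, M).2 != 0)) [M * _]mulrC.
rewrite !vM //.
apply: mono_orth_dvd; rewrite ?F0 // => z e.
apply: (hM (p.1 + p.2 * x - (q.1 + q.2 * x)) z); last by rewrite e addrC addKr.
by rewrite mem_filter subr_eq0 hx //=; apply: allpairs_f.
Qed.

Lemma exists_orthogonal_isometries (I : finType) :
  exists w : I -> A, forall i j, star (w i) * w j = (i == j)%:R.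
Proof.
have [f fi] := exists_injective_seq D_not_field.
pose F := [seq (f n, 1) | n <- iota 0 #|I|] : seq (D * D).
have F0 p : p \in F -> p.2 != 0 by case/mapP => n _ ->; exact: oner_neq0.
have [r r0 hr] := exists_separating_mono F0.
pose g (i : I) : D * D := (f (enum_rank i), 1).
have inF i : g i \in F by apply: map_f; rewrite mem_iota ltn_ord.
exists (fun i => v (g i) * v r) => i j; have [<-|ij] := eqVneq i j.
  rewrite starM -mulrA (mulrA _ (v _)) mono_isometry ?F0 ?inF // mul1r.
  exact: mono_isometry.
rewrite hr ?inF //; apply: contra ij => /eqP[/fi e].
by apply/eqP/enum_rank_inj/val_inj.
Qed.

(** Let w_k be orthogonal isometries and W = sum_k w_k z_k.  Then W^* W is the scalar
    mu and z_i = w_i^* W. *)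
Lemma norm_entry_le (I : finType) (z : I -> A) (mu : R[i]) (i : I) :
  \sum_k star (z k) * z k = mu *: (1 : A) -> `|z i| ^+ 2 <= `|mu|.
Proof.
move=> hz; have [w hw] := exists_orthogonal_isometries I.
pose W := \sum_k w k * z k.
have wW k : star (w k) * W = z k.
  rewrite mulr_sumr (bigD1 k) //= mulrA hw eqxx mul1r big1 ?addr0 // => l lk.
  by rewrite mulrA hw eq_sym (negbTE lk) mul0r.
have -> : `|z i| ^+ 2 = `|star (w i) * W| ^+ 2 by rewrite wW.
apply: (@le_trans _ _ (`|W| ^+ 2)).
  rewrite ler_sqr ?nnegrE ?normr_ge0 //; apply: le_trans (calg_normM _ _) _.
  by rewrite ler_piMl // norm_star norm_isometry // hw eqxx.
rewrite -calg_norm_starM star_sum mulr_suml (_ : \sum_k _ = mu *: (1 : A)).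
  by rewrite normrZ ler_piMr ?norm_one_le1.
by rewrite -hz; apply: eq_bigr => k _; rewrite starM -mulrA wW.
Qed.
End Monomials.

(** * Norm estimates from scalar matrices *)

Local Open Scope sesquilinear_scope.

Section GramSums.
Variables (R : realType) (A : cstarAlgType R).

Lemma gram_sum m n (U : 'M[R[i]]_(m, n)) (X : 'I_n -> A) :
  \sum_j star (\sum_i U j i *: X i) * (\sum_i U j i *: X i) =
  \sum_i \sum_k (U ^t* *m U) i k *: (star (X i) * X k).
Proof.
transitivity (\sum_j \sum_i \sum_k
    (Num.conj (U j i) * U j k) *: (star (X i) * X k)).
  apply: eq_bigr => j _; rewrite star_sum mulr_suml; apply: eq_bigr => i _.
  rewrite mulr_sumr; apply: eq_bigr => k _.
  by rewrite starZ mul_scalel mul_scaler scalerA.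
rewrite exchange_big; apply: eq_bigr => i _; rewrite exchange_big /=.
apply: eq_bigr => k _; rewrite -scaler_suml mxE; congr (_ *: _).
by apply: eq_bigr => j _; rewrite !mxE.
Qed.

(** Singular vectors of T, from the spectral theorem for T^* T: the columns of T P^*
    are orthogonal, and the largest d_i is the squared operator norm of T. *)
Lemma exists_diagonal_gram m n (T : 'M[R[i]]_(m, n)) :
  exists2 P : 'M[R[i]]_n, P *m P ^t* = 1%:M /\ P ^t* *m P = 1%:M &
  exists d : 'rV[R[i]]_n, (T *m P ^t*) ^t* *m (T *m P ^t*) = diag_mx d.
Proof.
set G := T ^t* *m T.
have Gt : G ^t* = G by rewrite /G trmx_mul map_mxM trmxCK.
have Gn : G \is normalmx by apply/normalmxP; rewrite Gt.
have Pu := spectral_unitarymx G; set P := spectralmx G in Pu *.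
have PP : P *m P ^t* = 1%:M by apply/unitarymxP.
have PP' : P ^t* *m P = 1%:M by exact: mulmx1C.
exists P => //; exists (spectral_diag G).
have /orthomx_spectralP := Gn; rewrite invmx_unitary -/P // => eG.
rewrite trmx_mul map_mxM trmxCK mulmxA -(mulmxA P) -/G {1}eG.
by rewrite !mulmxA PP mul1mx -mulmxA PP mulmx1.
Qed.

End GramSums.

Section RowEstimate.
Variables (R : realType) (D : idomainType).
Hypothesis D_not_field : ~ GRing.field_axiom D.
Hypothesis D_finite_quotients :
  forall m : D, m != 0 -> finite_set (residue_classes m).
Variables (A : cstarAlgType R) (s u : D -> A).
Hypothesis rel : ring_cstar_relations s u.

Lemma norm_le_sum_squares (y : A) (z : seq A) (mu : R[i]) :
  star y * y + \sum_(x <- z) star x * x = mu *: (1 : A) -> `|y| ^+ 2 <= `|mu|.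
Proof.
move=> h; pose f (i : 'I_(size z).+1) := nth 0 (y :: z) i.
apply: (norm_entry_le D_not_field D_finite_quotients rel (z := f) ord0).
rewrite big_ord_recl -h; congr (_ + _).
by rewrite (big_nth 0) big_mkord.
Qed.

(** Write T = U P with P unitary and U^* U diagonal with entries d_i, and let lambda
    be the largest d_i, which is |T z|^2 for a unit vector z.  With
    X_i = sum_k P_ik v_k^* and Z_j = sum_i T_ji v_i^*, one has sum_i X_i^* X_i = N and
    sum_j Z_j^* Z_j = sum_i d_i X_i^* X_i, while Z_j = w_j^* y for j in Q.  Therefore
    N' y^* y + sum_(j notin Q) Z_j^* Z_j + sum_i (lambda - d_i) X_i^* X_i = lambda N,
    and sums of squares control norms. *)
Lemma norm_le_matrix n m (v : 'I_n -> A) (w : 'I_m -> A) (T : 'M[R[i]]_(m, n))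
    (Q : pred 'I_m) (y : A) (N N' : nat) : (0 < n)%N ->
  \sum_i v i * star (v i) = N%:R ->
  \sum_(j | Q j) w j * star (w j) = N'%:R ->
  (forall j, Q j -> \sum_i T j i *: star (v i) = star (w j) * y) ->
  exists2 z : 'cV[R[i]]_n, \sum_i `|z i 0| ^+ 2 = 1 &
    N'%:R * `|y| ^+ 2 <= N%:R * \sum_j `|(T *m z) j 0| ^+ 2.
Proof.
move=> n0 hv hw hT; have [P [PP PP'] [d hd]] := exists_diagonal_gram T.
set U := T *m P ^t* in hd.
have dE i : d 0 i = \sum_j `|U j i| ^+ 2.
  have := congr1 (fun M : 'M[R[i]]_n => M i i) hd; rewrite !mxE eqxx mulr1n => <-.
  by apply: eq_bigr => j _; rewrite !mxE mulrC -normCK.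
have d0 i : 0 <= d 0 i by rewrite dE sumr_ge0 // => j _; rewrite exprn_ge0.
pose i0 := [arg max_(i > Ordinal n0) complex.Re (d 0 i)]%O.
have dmax i : d 0 i <= d 0 i0.
  have [a a0 ea] := ge0_complexP (d0 i); have [b b0 eb] := ge0_complexP (d0 i0).
  have : complex.Re (d 0 i) <= complex.Re (d 0 i0).
    by rewrite /i0; case: arg_maxP => // k _; exact.
  by rewrite ea eb lecR.
exists (\col_k Num.conj (P i0 k)).
  transitivity ((P *m P ^t*) i0 i0); last by rewrite PP mxE eqxx.
  rewrite mxE; by apply: eq_bigr => k _; rewrite !mxE norm_conjC normCK.
have -> : \sum_j `|(T *m \col_k Num.conj (P i0 k)) j 0| ^+ 2 = d 0 i0.
  rewrite dE; apply: eq_bigr => j _; congr (`|_| ^+ 2).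
  by rewrite !mxE; apply: eq_bigr => k _; rewrite !mxE.
set la := d 0 i0.
pose X i := \sum_k P i k *: star (v k).
pose Z j := \sum_i T j i *: star (v i).
have XX : \sum_i star (X i) * X i = N%:R.
  rewrite gram_sum PP' -hv; apply: eq_bigr => i _.
  rewrite (bigD1 i) //= mxE eqxx scale1r starK big1 ?addr0 // => k ki.
  by rewrite mxE eq_sym (negbTE ki) scale0r.
have ZX j : Z j = \sum_i U j i *: X i.
  have TUP : T = U *m P by rewrite -mulmxA PP' mulmx1.
  rewrite /Z TUP; under [RHS]eq_bigr do rewrite scaler_sumr.
  rewrite exchange_big; apply: eq_bigr => k _; rewrite mxE scaler_suml.
  by apply: eq_bigr => i _; rewrite scalerA.
have ZZ : \sum_j star (Z j) * Z j = \sum_i d 0 i *: (star (X i) * X i).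
  under eq_bigr do rewrite ZX.
  rewrite gram_sum hd; apply: eq_bigr => i _.
  rewrite (bigD1 i) //= !mxE eqxx mulr1n big1 ?addr0 // => k ki.
  by rewrite !mxE eq_sym (negbTE ki) scale0r.
have yy : \sum_(j | Q j) star (Z j) * Z j = N'%:R *: (star y * y).
  transitivity (star y * (\sum_(j | Q j) w j * star (w j)) * y).
    rewrite mulr_sumr mulr_suml; apply: eq_bigr => j Qj.
    by rewrite /Z hT // starM starK !mulrA.
  by rewrite hw mulr_natr mulrnAl scaler_nat.
have sq_scale (a : R[i]) (x : A) : 0 <= a ->
    star (sqrtC a *: x) * (sqrtC a *: x) = a *: (star x * x).
  move=> a0; rewrite starZ mul_scalel mul_scaler scalerA.
  by rewrite conj_Creal ?ger0_real ?sqrtC_ge0 // -expr2 sqrtCK.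
have := @norm_le_sum_squares (sqrtC N'%:R *: y)
  ([seq sqrtC (la - d 0 i) *: X i | i <- index_enum 'I_n] ++
   [seq Z j | j <- index_enum 'I_m & ~~ Q j]) (la * N%:R).
have laN : `|la * N%:R| = la * N%:R by rewrite ger0_norm ?mulr_ge0 ?ler0n ?d0.
rewrite normrZ exprMn -normrX sqrtCK normr_nat laN.
rewrite [la * _]mulrC; apply.
rewrite sq_scale ?ler0n // big_cat /= 2!big_map big_filter /=.
have ZQ : \sum_j star (Z j) * Z j =
    \sum_(j | Q j) star (Z j) * Z j + \sum_(j | ~~ Q j) star (Z j) * Z j.
  by rewrite (bigID Q).
rewrite -yy addrCA -ZQ ZZ -big_split /=.
transitivity (\sum_i la *: (star (X i) * X i)).
  by apply: eq_bigr => i _; rewrite sq_scale ?subr_ge0 // scalerBl subrK.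
by rewrite -scaler_sumr XX mulrC -scalerA scaler_nat.
Qed.
End RowEstimate.

(** * Sets with little boundary in commutative monoids *)
Section Folner.
Variables (T : eqType) (idx : T) (op : Monoid.com_law idx) (S : seq T).

Fixpoint words n : seq T :=
  if n is n'.+1 then undup [seq op x b | x <- S, b <- words n'] else [:: idx].

Lemma words_uniq n : uniq (words n).
Proof. by case: n => //= n; exact: undup_uniq. Qed.

Lemma wordsS n x b : x \in S -> b \in words n -> op x b \in words n.+1.
Proof. by move=> xS bW; rewrite /= mem_undup; apply: allpairs_f. Qed.

Lemma words_ind (P : T -> Prop) : P idx ->
  (forall x b, x \in S -> P b -> P (op x b)) -> forall n b, b \in words n -> P b.
Proof.
move=> P0 PS; elim=> [|n IH] b /=; first by rewrite inE => /eqP ->.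
by rewrite mem_undup => /allpairsP[[x c] /= [xS /IH cW ->]]; exact: PS.
Qed.

Let pw x k := iter k (op x) idx.

(** By commutativity a word is determined by the exponents of the elements of S; this
    gives the polynomial bound on the number of words. *)
Lemma words_exponents n b : b \in words n ->
  exists2 f : {ffun 'I_(size S) -> 'I_n.+1},
    true & b = \big[op/idx]_(i < size S) pw (tnth (in_tuple S) i) (f i).
Proof.
elim: n b => [|n IH] b /=.
  rewrite inE => /eqP ->; exists [ffun => ord0] => //.
  by rewrite big1 // => i _; rewrite ffunE.
rewrite mem_undup => /allpairsP[[x c] /= [xS /IH [f _ ->] ->]].
have /tnthP[i0 ei0] : x \in in_tuple S by [].
pose g i : nat := (f i + (i == i0))%N.
have gb i : (g i < n.+2)%N.
  by rewrite /g ltnS; apply: leq_trans (leq_add (leq_ord _) (leq_b1 _)) _; rewrite addn1.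
exists [ffun i => Ordinal (gb i)] => //.
rewrite (bigD1 i0) //= [RHS](bigD1 i0) //= ffunE /= /g eqxx addn1 /pw iterS.
rewrite Monoid.mulmA ei0; congr (op _ _); apply: eq_bigr => i ii0.
by rewrite ffunE /= (negbTE ii0) addn0.
Qed.

Lemma size_words n : (size (words n) <= n.+1 ^ size S)%N.
Proof.
pose F (f : {ffun 'I_(size S) -> 'I_n.+1}) :=
  \big[op/idx]_(i < size S) pw (tnth (in_tuple S) i) (f i).
have -> : (n.+1 ^ size S = size [seq F f | f : {ffun 'I_(size S) -> 'I_n.+1}])%N.
  by rewrite size_map -cardE card_ffun !card_ord.
apply: uniq_leq_size; first exact: words_uniq.
by move=> b /words_exponents[f _ ->]; apply/mapP; exists f; rewrite ?mem_enum.
Qed.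

Lemma exists_exp2_gt r : exists n, (n.+1 ^ r < 2 ^ n)%N.
Proof.
pose i := r.+4; pose j := (2 * i)%N.
have lt_id k : (k < 2 ^ k)%N by exact: ltn_expl.
exists (2 ^ j).-1; rewrite prednK ?expn_gt0 // -expnM ltn_exp2l //.
rewrite -ltnS prednK ?expn_gt0 //.
have h2 : (2 * i <= 2 ^ i)%N.
  rewrite /i; elim: r {i j} => [|r IH] //; rewrite expnS (leq_trans _ (leq_mul (leqnn 2) IH)) //.
  by rewrite leq_pmul2l // mul2n -addnn -addn1 leq_add.
have h1 : (r.+1 <= 2 ^ i)%N by apply: leq_trans (ltnW (lt_id i)); do 3 apply: leqW.
rewrite {2}/j mul2n -addnn expnD.
apply: leq_trans (leq_mul h2 h1); rewrite -/j mulnS.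
rewrite -[X in (X < _)%N]add1n ltn_add2r; exact: (@leq_mul 2 1 2 i).
Qed.

(** The number of words of length n grows polynomially with n, so that it cannot
    double at every step. *)
Lemma exists_small_doubling : exists n, (size (words n.+1) <= 2 * size (words n))%N.
Proof.
apply: contrapT => h.
have grow n : (2 ^ n <= size (words n))%N.
  elim: n => // n IH; rewrite expnS; apply: leq_trans (leq_mul (leqnn 2) IH) _.
  by rewrite leqNgt; apply/negP => lt; apply: h; exists n; exact: ltnW.
have [n hn] := exists_exp2_gt (size S).
by move: (leq_trans hn (grow n)); rewrite ltnNge size_words.
Qed.
End Folner.

Lemma exists_folner_pair (T : eqType) (idx : T) (op : Monoid.com_law idx)
    (S : seq T) (P : T -> Prop) : P idx ->
  (forall x b, x \in S -> P b -> P (op x b)) ->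
  exists B B' : seq T, [/\ uniq B, uniq B', (0 < size B)%N /\ (0 < size B')%N,
    (size B' <= 2 * size B)%N &
    [/\ forall b, b \in B -> P b, forall b, b \in B' -> P b &
        forall x b, x \in S -> b \in B -> op x b \in B']].
Proof.
(* The unit keeps the sets of words nonempty when S is empty. *)
move=> P0 PS; pose S1 := idx :: S.
have PS1 x b : x \in S1 -> P b -> P (op x b).
  by rewrite inE => /predU1P[->|xS]; [rewrite Monoid.mul1m|exact: PS].
have [n hn] := exists_small_doubling op S1.
have words_gt0 k : (0 < size (words op S1 k))%N.
  suff : idx \in words op S1 k by case: words.
  elim: k => [|k IH]; first by rewrite inE.
  by have := wordsS (mem_head idx S) IH; rewrite Monoid.mul1m.
exists (words op S1 n), (words op S1 n.+1); split; rewrite ?words_uniq //.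
split; try exact: (words_ind P0 PS1).
by move=> x b xS; apply: wordsS; rewrite inE xS orbT.
Qed.

(** * Boxes in the semigroup of affine maps *)

Section Boxes.
Variable D : idomainType.
Hypothesis D_finite_quotients :
  forall m : D, m != 0 -> finite_set (residue_classes m).

Definition dv (x m : D) : D := xget 0 [set z | x = m * z].

Lemma dvK (m z : D) : m != 0 -> dv (m * z) m = z.
Proof. by move=> m0; apply: xget_unique => // y /(mulfI m0). Qed.

Definition quo (m n : D) : D := xget 0 [set z | n - m * z \in reps m].

Lemma quoP m n : m != 0 -> n - m * quo m n \in reps m.
Proof.
move=> m0; have [r r_in [z e]] := reps_exists D_finite_quotients n m0.
by apply: (xgetPex 0 (P := [set z | n - m * z \in reps m])); exists z; rewrite /= e addrK.
Qed.

(** All pairs (a, k) with k in K whose a has its quotient by k in B.  For fixed k and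
    b, the v(r + k b, k) = v(r, k) u^b have range projections with sum 1 when r runs
    through the residues modulo k. *)
Definition box (K B : seq D) : seq (D * D) :=
  [seq (kr.2 + kr.1 * b, kr.1) | kr <- [seq (k, r) | k <- K, r <- reps k], b <- B].

Lemma mem_boxP K B p : reflect
  (exists r b, [/\ p.2 \in K, r \in reps p.2, b \in B & p.1 = r + p.2 * b])
  (p \in box K B).
Proof.
apply: (iffP idP).
  move=> /allpairsPdep[_ [b [/allpairsPdep[k [r [kK rk ->]]] bB ->]]] /=.
  by exists r, b.
case: p => x k [r [b /= [kK rk bB ->]]].
apply/allpairsPdep; exists (k, r), b; split => //.
by apply/allpairsPdep; exists k, r.
Qed.

Lemma box_uniq K B : uniq K -> uniq B -> (forall k, k \in K -> k != 0) ->
  uniq (box K B).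
Proof.
move=> uK uB K0; apply: allpairs_uniq => //.
  apply: allpairs_uniq_dep => //; first by move=> k /K0; exact: reps_uniq.
  by move=> [k r] [k' r'] _ _ /= [-> ->].
have mem_kr (x : D * D * D) :
    x \in [seq (kr, b) | kr <- [seq (k, r) | k <- K, r <- reps k], b <- B] ->
    x.1.1 \in K /\ x.1.2 \in reps x.1.1.
  move=> /allpairsP[[kr b] /= [kr_in _ ->]] /=.
  by move: kr_in => /allpairsPdep[k [r [kK rk ->]]].
move=> [[k r] b] [[k' r'] b'] /mem_kr /= [kK rk] /mem_kr /= [_ rk'].
rewrite /uncurry /= => -[e ek]; subst k'.
have k0 := K0 _ kK.
have er : r = r'.
  apply: (reps_congr D_finite_quotients (m := k) (z := b' - b)) => //.
  by rewrite mulrBr addrA -e addrK.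
by move: e; rewrite er => /addrI /(mulfI k0) ->.
Qed.
End Boxes.

(** * Compressing isometries *)

Section MainEstimate.
Variables (R : realType) (D : idomainType).
Hypothesis D_not_field : ~ GRing.field_axiom D.
Hypothesis D_finite_quotients :
  forall m : D, m != 0 -> finite_set (residue_classes m).
Variables (A : cstarAlgType R) (s u : D -> A).
Hypothesis rel : ring_cstar_relations s u.
Local Notation v := (mono s u).
Local Notation K := R[i].

Lemma sum_box (Ks B : seq D) : (forall k, k \in Ks -> k != 0) ->
  \sum_(p <- box Ks B) v p * star (v p) = (size Ks * size B)%:R.
Proof.
move=> K0; rewrite big_allpairs_dep /= big_allpairs_dep /= mulnC natrM.
transitivity (\sum_(k <- Ks) (size B)%:R : A); last first.
  by rewrite big_const_seq count_predT iter_addr_0 mulr_natr.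
rewrite big_seq [RHS]big_seq; apply: eq_bigr => k /K0 k0.
rewrite exchange_big /=; transitivity (\sum_(b <- B) (1 : A)); last first.
  by rewrite big_const_seq count_predT iter_addr_0.
apply: eq_bigr => b _; rewrite -(sum_reps D_finite_quotients rel k0).
apply: eq_bigr => r _; rewrite (_ : v (r + k * b, k) = v (r, k) * u b).
  by rewrite starM !mulrA -(mulrA _ (u b)) (u_unitaryr rel) mulr1.
by rewrite /mono /= -(u_add rel) -!mulrA (s_u_comm rel).
Qed.

Definition normal_form (M : D) (L : seq (K * (D * D) * D)) : A :=
  \sum_(l <- L) l.1.1 *: (v l.1.2 * star (v (l.2, M))).

Lemma sum_pred1 (I : eqType) (S : seq I) (x : I) (F : I -> A) :
  uniq S -> x \in S -> \sum_(i <- S | i == x) F i = F x.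
Proof.
by move=> uS xS; rewrite -big_filter filter_pred1_uniq // big_seq1.
Qed.

Lemma orthonormal_sum (n : nat) (c : 'I_n -> K) (x : 'I_n -> A) :
  (forall i j, star (x i) * x j = (i == j)%:R) ->
  star (\sum_i c i *: x i) * (\sum_i c i *: x i) = (\sum_i `|c i| ^+ 2) *: (1 : A).
Proof.
move=> hx; rewrite star_sum mulr_suml scaler_suml; apply: eq_bigr => i _.
rewrite mulr_sumr (bigD1 i) //= big1 ?addr0 => [|j ji].
  by rewrite starZ mul_scalel mul_scaler scalerA hx eqxx mulrC -normCK.
by rewrite starZ mul_scalel mul_scaler hx eq_sym (negbTE ji) !scaler0.
Qed.

Section Transfer.
Variables (M : D) (L : seq (K * (D * D) * D)).
Hypothesis M0 : M != 0.
Hypothesis L0 : forall l, l \in L -> l.1.2.2 != 0.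
Let y := normal_form M L.

(* If p = (b_l, M) t for some t, then t = quotient p l and source p l = p; the term
   c_l v(p_l) v(b_l, M)^* of y then sends v(p) to c_l v(p_l t). *)
Let quotient (p : D * D) (l : K * (D * D) * D) := (dv (p.1 - l.2) M, dv p.2 M).
Let source p (l : K * (D * D) * D) := pmul (l.2, M) (quotient p l).
Let target p (l : K * (D * D) * D) := pmul l.1.2 (quotient p l).
Let linked l q p := (p == source p l) && (q == target p l).
(** The matrix of left multiplication by y on the span of the v(p). *)
Definition transfer_coef q p : K := \sum_(l <- L | linked l q p) l.1.1.
Definition targets (F : seq (D * D)) := [seq target p l | p <- F, l <- L].

(** [P] puts the pair of fixed index p and summation index q in either order, so that
    the identity serves for the rows and for the columns of the transfer matrix. *)
Lemma transfer_exchange (S : seq (D * D)) (P : D * D -> D * D -> D * D * (D * D)) (F : D * D -> A) p :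
  \sum_(q <- S) transfer_coef (P p q).1 (P p q).2 *: F q =
  \sum_(l <- L) l.1.1 *: \sum_(q <- S | linked l (P p q).1 (P p q).2) F q.
Proof.
under eq_bigr do rewrite scaler_suml.
rewrite (exchange_big_dep xpredT) //=; apply: eq_bigr => l _.
by rewrite scaler_sumr.
Qed.

(** When M divides p.2, each v(b_l, M)^* v(p) is either v(t) with p = (b_l, M) t or 0;
    otherwise it need not be a monomial. *)
Lemma transfer_source F S p : uniq S -> {subset targets F <= S} -> p \in F ->
  p.2 != 0 -> (exists k, p.2 = M * k) ->
  y * v p = \sum_(q <- S) transfer_coef q p *: v q.
Proof.
move=> uS FS pF p0 [k ek].
rewrite (transfer_exchange S (fun p q => (q, p)) _ p) /=.
rewrite /y /normal_form mulr_suml big_seq [RHS]big_seq; apply: eq_bigr => l lL.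
rewrite mul_scalel; congr (_ *: _).
have k0 : k != 0 by apply: contraNneq p0 => k0; rewrite ek k0 mulr0.
have qk : dv p.2 M = k by rewrite ek dvK.
have [pl|pl] := eqVneq p (source p l).
  rewrite (eq_bigl (fun q => q == target p l)); last first.
    by move=> q; rewrite /linked -pl eqxx.
  rewrite sum_pred1 //; last by apply: FS; apply: allpairs_f.
  have q0 : (quotient p l).2 != 0 by rewrite /= qk.
  rewrite {1}pl -(monoM rel _ q0 : _ = v (source p l)) // -mulrA (mulrA _ (v (l.2, M))).
  rewrite (mono_isometry rel (p := (l.2, M))) // mul1r.
  by rewrite (monoM rel) // L0.
rewrite big_pred0 => [|q]; last by rewrite /linked (negbTE pl).
rewrite -mulrA [X in _ * X](_ : _ = 0) ?mulr0 //.
case: p p0 ek qk pl {pF} => p1 p2 /= p0 ek qk pl.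
have := mono_orth_dvd D_finite_quotients rel M0 (oner_neq0 D) k0.
rewrite mulr1 ek; apply=> z e; move/eqP: pl; apply; rewrite /source /pmul /= /quotient /= qk.
have -> : p1 - l.2 = M * (- z) by rewrite e opprD addNKr mulrN.
by rewrite dvK // -ek mulrN e addrK.
Qed.

(** The adjoint statement: when p_l.2 divides q.2, each v(q)^* v(p_l) is either v(t)^*
    with q = p_l t or 0. *)
Lemma transfer_target F q : uniq F ->
  (forall l, l \in L -> exists2 k, k != 0 & q.2 = l.1.2.2 * k) ->
  (forall l t, l \in L -> q = pmul l.1.2 t -> pmul (l.2, M) t \in F) ->
  \sum_(p <- F) transfer_coef q p *: star (v p) = star (v q) * y.
Proof.
move=> uF hq hF.
rewrite (transfer_exchange F (fun q p => (q, p)) _ q) /=.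
rewrite /y /normal_form mulr_sumr big_seq [RHS]big_seq; apply: eq_bigr => l lL.
rewrite mul_scaler; congr (_ *: _); have [k k0 ek] := hq l lL; have m0 := L0 lL.
have [[d ed]|nd] := pselect (exists d, q.1 = l.1.2.1 + l.1.2.2 * d).
  have eq : q = pmul l.1.2 (d, k) by rewrite /pmul /= -ed -ek; case: (q).
  have p0F := hF l (d, k) lL eq; set p0 := pmul _ _ in p0F.
  have qp0 : quotient p0 l = (d, k).
    by rewrite /quotient /p0 /pmul /= addrAC subrr add0r !dvK.
  rewrite (eq_bigl (fun p => p == p0)) => [|p].
    rewrite sum_pred1 // eq -(monoM rel m0 (k0 : (d, k).2 != 0)) starM -mulrA.
    rewrite (mulrA _ (v l.1.2)) (mono_isometry rel m0) mul1r.
    by rewrite -starM (monoM rel).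
  apply/andP/eqP => [[/eqP ep /eqP eq']|->].
    rewrite ep /source /p0; congr (pmul _ _).
    have := eq'; rewrite eq /target /pmul => -[/addrI /(mulfI m0) e1 /(mulfI m0) e2].
    by rewrite /quotient -e1 -e2.
  by rewrite /source /target qp0 -eq !eqxx.
rewrite big_pred0 => [|p].
  rewrite mulrA [X in X * _](_ : _ = 0) ?mul0r //.
  case: q ek nd {hq hF} => q1 q2 /= ek nd.
  case: l lL k0 ek m0 nd => [[c [a m]] b] /= lL k0 ek m0 nd.
  have := mono_orth_dvd D_finite_quotients rel m0 k0 (oner_neq0 D).
  by rewrite mulr1 ek; apply=> z e; apply: nd; exists z.
apply/negP => /andP[_ /eqP e]; apply: nd.
by exists (dv (p.1 - l.2) M); rewrite e.
Qed.
End Transfer.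

(** F' uses second coordinates M X b with b in B1, where X is M times the product of
    the m_l.  They are divisible by m_l, and replacing the factor m_l by M produces
    M (M cof_l) b, so F has to contain the second coordinates M b' for b' in
    {M cof_l} B1: this is a multiplicative set with little boundary.  For the first
    coordinates, a box element (r + k b, k) of F' is sent to one whose quotient is b
    plus a shift depending only on l, b1 and r, that is, on finitely many data: this
    is an additive set with little boundary.  Each of the two steps at most doubles the
    sizes, whence the factor 4. *)
Lemma exists_folner_boxes (M : D) (L : seq (K * (D * D) * D)) : M != 0 ->
  (forall l, l \in L -> l.1.2.2 != 0) ->
  exists F F' : seq (D * D), exists N N' : nat,
  [/\ uniq F /\ (0 < size F)%N, uniq F', (0 < N')%N /\ (N <= 4 * N')%N,
    \sum_(p <- F) v p * star (v p) = N%:R /\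
    \sum_(q <- F') v q * star (v q) = N'%:R &
    [/\ forall p, p \in F -> p.2 != 0 /\ exists k, p.2 = M * k,
        forall q, q \in F' -> q.2 != 0,
        forall l q, l \in L -> q \in F' -> exists2 k, k != 0 & q.2 = l.1.2.2 * k &
        forall l t, l \in L -> pmul l.1.2 t \in F' -> pmul (l.2, M) t \in F]].
Proof.
move=> M0 L0.
pose m (l : K * (D * D) * D) := l.1.2.2.
pose cof l := M * \prod_(l' <- rem l L) m l'.
pose X := M * \prod_(l <- L) m l.
have XE l : l \in L -> X = m l * cof l.
  by move=> lL; rewrite /X (perm_big _ (perm_to_rem lL)) big_cons mulrCA.
have prod0 (S : seq (K * (D * D) * D)) : {subset S <= L} -> \prod_(l <- S) m l != 0.
  move=> SL; apply/negP; rewrite prodf_seq_eq0 => /hasP[l /SL /L0].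
  by rewrite /m => /negbTE /= ->.
have X0 : X != 0 by rewrite mulf_neq0 // prod0.
have cof0 l : cof l != 0 by rewrite mulf_neq0 // prod0 // => l'; exact: mem_rem.
have step0 x b : x \in [seq M * cof l | l <- L] -> b != 0 -> x * b != 0.
  by move=> /mapP[l _ ->] b0; exact: mulf_neq0 (mulf_neq0 M0 (cof0 l)) b0.
have [B1 [B1' [uB1 uB1' [sB1 sB1'] dB1 [B10 B10' stepB1]]]] :=
  exists_folner_pair (op := *%R) (P := fun b => b != 0) (oner_neq0 D) step0.
pose Ks' := [seq M * (X * b) | b <- B1]; pose Ks := [seq M * b | b <- B1'].
pose lev l b := M * cof l * b.
have lev0 l b : b \in B1 -> lev l b != 0 by move=> /B10 b0; exact: mulf_neq0 (mulf_neq0 M0 (cof0 l)) b0.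
pose shift (x : K * (D * D) * D * D * D) :=
  let: (l, b, r) := x in
  quo (M * lev l b) (l.2 + M * dv (r - l.1.2.1) (m l)).
pose S2 := [seq shift x | x <- [seq (x, r) | x <- [seq (l, b) | l <- L, b <- B1],
                                  r <- reps (M * (X * x.2))]].
have [B2 [B2' [uB2 uB2' [sB2 sB2'] dB2 [_ _ stepB2]]]] :=
  @exists_folner_pair D 0 +%R S2 xpredT isT (fun _ _ _ _ => isT).
have Ks0 k : k \in Ks -> k != 0 by move=> /mapP[b /B10' b0 ->]; rewrite mulf_neq0.
have Ks'0 k : k \in Ks' -> k != 0 by move=> /mapP[b /B10 b0 ->]; exact: mulf_neq0 M0 (mulf_neq0 X0 b0).
have uKs : uniq Ks by rewrite map_inj_uniq // => x z /(mulfI M0).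
have uKs' : uniq Ks' by rewrite map_inj_uniq // => x z /(mulfI M0) /(mulfI X0).
have levE l b : l \in L -> M * (X * b) = m l * lev l b.
  by move=> lL; rewrite (XE _ lL) /lev; ring.
exists (box Ks B2'), (box Ks' B2).
exists (size Ks * size B2')%N, (size Ks' * size B2)%N.
split.
- split; first exact: box_uniq.
  have [k k_in] : exists k, k \in Ks.
    by move: sB1'; rewrite /Ks; case: (B1') => //= k *; exists (M * k); rewrite mem_head.
  have [b b_in] : exists b, b \in B2'.
    by move: sB2'; case: (B2') => //= b *; exists b; rewrite mem_head.
  have [r r_in _] := reps_exists D_finite_quotients 0 (Ks0 _ k_in).
  suff : (r + k * b, k) \in box Ks B2' by case: box.
  by apply/mem_boxP; exists r, b.
- exact: box_uniq.
- rewrite muln_gt0 !size_map sB1 sB2; split => //.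
  by rewrite -[4%N]/(2 * 2)%N mulnACA leq_mul.
- by rewrite !sum_box.
split.
- move=> p /mem_boxP[r [b [pK _ _ _]]]; split; first exact: Ks0.
  by move/mapP: pK => [k _ ->]; exists k.
- by move=> q /mem_boxP[r [b [qK _ _ _]]]; exact: Ks'0.
- move=> l q lL /mem_boxP[r [b [/mapP[b1 b1B ->] _ _ _]]].
  by exists (lev l b1); [exact: lev0|exact: levE].
move=> l t lL /mem_boxP[r [b2 [/mapP[b1 b1B /= e2] rr b2B /= e1]]].
have m0 : m l != 0 := L0 _ lL.
have et : t.2 = lev l b1 by apply: (mulfI m0); rewrite -levE // -e2.
pose d := t.1 - lev l b1 * b2.
have ed : r - l.1.2.1 = m l * d.
  rewrite /d mulrBr mulrA -levE // -e2 -/(m l); apply/eqP.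
  by rewrite subr_eq addrAC eq_sym subr_eq addrC -e1.
pose n := l.2 + M * d.
have quo_in : quo (M * lev l b1) n \in S2.
  apply/mapP; exists (l, b1, r); last by rewrite /shift ed dvK.
  apply/allpairsPdep; exists (l, b1), r; split => //; first exact: allpairs_f.
  by rewrite /= -e2.
apply/mem_boxP; exists (n - M * lev l b1 * quo (M * lev l b1) n).
exists (quo (M * lev l b1) n + b2); rewrite /pmul /= et; split.
- apply: (map_f (fun b => M * b)); apply: stepB1 => //.
  exact: map_f.
- by apply: quoP => //; rewrite mulf_neq0 // lev0.
- exact: stepB2.
by rewrite /n /d; ring.
Qed.

(** Take the unit vector z at which the transfer matrix T is large, and
    W = sum_i z_i v(p_i) v(r) with r separating all pairs involved.  Then
    y W = sum_j (T z)_j v(q_j) v(r). *)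
Lemma exists_compressing_isometry (M : D) (L : seq (K * (D * D) * D)) : M != 0 ->
  (forall l, l \in L -> l.1.2.2 != 0) -> let y := normal_form M L in
  exists W : A, exists2 la : K, star W * W = 1 /\ star (y * W) * (y * W) = la *: (1 : A) &
    0 <= la /\ `|y| ^+ 2 <= 4 * la.
Proof.
move=> M0 L0 y.
have [F [F' [N [N' [[uF Fpos] uF' [N'0 NN'] [sF sF'] [F_lev F'0 F'_lev shiftF]]]]]] :=
  exists_folner_boxes M0 L0.
pose FF := undup (F' ++ targets M L F).
have F0 p : p \in F -> p.2 != 0 by move=> /F_lev[].
have FF0 q : q \in FF -> q.2 != 0.
  rewrite mem_undup mem_cat => /orP[/F'0 //|/allpairsP[[p l] /= [pF lL ->]]].
  have [p0 [k ek]] := F_lev p pF.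
  rewrite /pmul /= ek dvK // mulf_neq0 ?L0 //.
  by apply: contraNneq p0 => k0; rewrite ek k0 mulr0.
have uFF : uniq FF by exact: undup_uniq.
have targets_sub : {subset targets M L F <= FF}.
  by move=> q; rewrite mem_undup mem_cat orbC => ->.
have F'_sub : {subset F' <= FF} by move=> q; rewrite mem_undup mem_cat => ->.
pose vF := tnth (in_tuple F); pose vFF := tnth (in_tuple FF).
have vFin i : vF i \in F by rewrite -[F in _ \in F]/(val (in_tuple F)) mem_tnth.
have vFFin j : vFF j \in FF by rewrite -[FF in _ \in FF]/(val (in_tuple FF)) mem_tnth.
pose T := \matrix_(j < size FF, i < size F) transfer_coef M L (vFF j) (vF i).
pose Q j := vFF j \in F'.
have hv : \sum_i v (vF i) * star (v (vF i)) = N%:R.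
  by rewrite -sF [RHS]big_tnth.
have hw : \sum_(j | Q j) v (vFF j) * star (v (vFF j)) = N'%:R.
  rewrite -sF' -(big_tnth _ _ FF (mem F') (fun q => v q * star (v q))) -big_filter.
  apply: perm_big; apply: uniq_perm => //; first exact: filter_uniq.
  by move=> q; rewrite mem_filter; apply: andb_idr; exact: F'_sub.
have hT j : Q j -> \sum_i T j i *: star (v (vF i)) = star (v (vFF j)) * y.
  move=> Qj; rewrite -(transfer_target M0 L0 uF) //.
  - by rewrite [RHS]big_tnth; apply: eq_bigr => i _; rewrite mxE.
  - by move=> l lL; exact: F'_lev.
  - by move=> l t lL e; apply: shiftF => //; rewrite -e.
have [z z1 hz] := norm_le_matrix D_not_field D_finite_quotients rel Fpos hv hw hT.
have yv i : y * v (vF i) = \sum_j T j i *: v (vFF j).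
  have pF := vFin i; have [p0 pM] := F_lev _ pF.
  rewrite (transfer_source M0 L0 uFF targets_sub pF p0 pM) big_tnth.
  by apply: eq_bigr => j _; rewrite mxE.
have [r r0 hr] : exists2 r : D * D, r.2 != 0 & forall p q, p \in F ++ FF ->
    q \in F ++ FF -> p != q -> star (v p * v r) * (v q * v r) = 0.
  apply: (exists_separating_mono D_not_field D_finite_quotients rel).
  by move=> p; rewrite mem_cat => /orP[/F0|/FF0].
have orth (n : nat) (f : 'I_n -> D * D) : injective f ->
    (forall i, f i \in F ++ FF) ->
    forall i j, star (v (f i) * v r) * (v (f j) * v r) = (i == j)%:R.
  move=> f_inj f_in i j; have [<-|ij] := eqVneq i j.
    have f0 : (f i).2 != 0 by have := f_in i; rewrite mem_cat => /orP[/F0|/FF0].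
    rewrite starM -mulrA (mulrA _ (v (f i))) (mono_isometry rel f0) mul1r.
    exact: (mono_isometry rel).
  by rewrite hr ?f_in // (inj_eq f_inj).
have vF_inj : injective vF by apply/tuple_uniqP.
have vFF_inj : injective vFF by apply/tuple_uniqP.
exists (\sum_i z i 0 *: (v (vF i) * v r)), (\sum_j `|(T *m z) j 0| ^+ 2).
  split.
    rewrite (orthonormal_sum _ (orth _ _ vF_inj _)) ?z1 ?scale1r // => i.
    by rewrite mem_cat vFin.
  have -> : y * (\sum_i z i 0 *: (v (vF i) * v r)) =
      \sum_j (T *m z) j 0 *: (v (vFF j) * v r).
    transitivity (\sum_i \sum_j (T j i * z i 0) *: (v (vFF j) * v r)).
      rewrite mulr_sumr; apply: eq_bigr => i _.
      rewrite mul_scaler mulrA yv mulr_suml scaler_sumr; apply: eq_bigr => j _.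
      by rewrite mul_scalel scalerA mulrC.
    rewrite exchange_big; apply: eq_bigr => j _ /=.
    by rewrite -scaler_suml mxE.
  rewrite (orthonormal_sum _ (orth _ _ vFF_inj _)) // => j.
  by rewrite mem_cat vFFin orbT.
have la0 : 0 <= \sum_j `|(T *m z) j 0| ^+ 2 by rewrite sumr_ge0 // => j _; rewrite exprn_ge0.
split => //; rewrite -(ler_pM2l (_ : 0 < N'%:R :> K)) ?ltr0n //.
apply: le_trans hz _; rewrite mulrA ler_wpM2r // mulrC -natrM ler_nat.
exact: NN'.
Qed.
End MainEstimate.

(** * Inverting by Neumann series *)

Section Neumann.
Variables (R : realType) (A : cstarAlgType R).
Implicit Types (x z : A).

Lemma norm_exp_half z n : `|z| <= 2^-1 -> `|z ^+ n| <= 2^-1 ^+ n.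
Proof.
move=> hz; elim: n => [|n IH]; first by rewrite !expr0 norm_one_le1.
rewrite !exprS; apply: le_trans (calg_normM _ _) _.
by apply: ler_pM => //; exact: normr_ge0.
Qed.

Lemma exp_half_lt (e : R[i]) : 0 < e -> exists n, 2^-1 ^+ n < e.
Proof.
move=> e0; have [r _ er] := ge0_complexP (ltW e0).
have r0 : 0 < r by rewrite -ltcR -er.
pose n := (Num.trunc r^-1).+1; exists n.
rewrite exprVn invf_plt ?posrE ?exprn_gt0 // er -[2](rmorph_nat (real_complex R)).
rewrite -rmorphXn -fmorphV ltcR; apply: lt_trans (truncnS_gt _) _.
by rewrite -natrX ltr_nat ltn_expl.
Qed.

Lemma left_inverse_near1 z : `|z| <= 2^-1 -> exists a : A, a * (1 - z) = 1.
Proof.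
move=> hz; pose S := fix S n : A := if n is n'.+1 then 1 + S n' * z else 0.
have Sz n : S n * (1 - z) = 1 - z ^+ n.
  elim: n => [|n IH]; first by rewrite /= mul0r expr0 subrr.
  have zC : z * (1 - z) = (1 - z) * z by rewrite mulrBr mulrBl mulr1 mul1r.
  rewrite /= mulrDl mul1r -mulrA zC mulrA IH mulrBl mul1r exprSr.
  by rewrite addrA subrK.
have SS n : S n.+1 = S n + z ^+ n.
  elim: n => [|n IH]; first by rewrite /= mul0r addr0 add0r expr0.
  by rewrite [LHS]/= -/(S n.+1) {1}IH mulrDl -exprSr addrA.
have S_dist n k : `|S (n + k)%N - S n| <= 2 * 2^-1 ^+ n - 2 * 2^-1 ^+ (n + k).
  elim: k => [|k IH]; first by rewrite addn0 !subrr normr0.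
  rewrite addnS SS addrAC; apply: le_trans (ler_normD _ _) _.
  apply: le_trans (lerD IH (norm_exp_half _ hz)) _.
  rewrite exprS [2 * (2^-1 * _)]mulrA divff ?pnatr_eq0 // mul1r.
  by rewrite -addrA lerD2l mulr_natl mulr2n opprD addrNK.
have S_dist' n m : (n <= m)%N -> `|S n - S m| <= 2 * 2^-1 ^+ n.
  move=> nm; rewrite distrC -(subnKC nm); apply: le_trans (S_dist _ _) _.
  by rewrite gerBl mulr_ge0 // exprn_ge0.
have S_cvg : cvg (S @ \oo).
  apply: cauchy_cvg; apply: cauchy_exP => e e0.
  have [n hn] := exp_half_lt (divr_gt0 e0 (ltr0Sn R[i] 1)).
  exists (S n); exists n => // m /= nm; rewrite -ball_normE /=.
  by apply: le_lt_trans (S_dist' _ _ nm) _; rewrite mulrC -ltr_pdivlMr.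
have [a Sa] : exists a : A, S @ \oo --> a by exists (limn S).
exists a; apply/eqP; rewrite -subr_eq0 -normr_eq0; apply/negP => /negP n0.
set e := `|_| in n0; have e0 : 0 < e by rewrite lt_def n0 normr_ge0.
have e40 : 0 < e / 4 by rewrite divr_gt0.
have [n1 _ h1] := proj1 (cvgrPdist_lt _ _) Sa _ e40.
have [n2 h2] := exp_half_lt e40.
pose m := maxn n1 n2.
have hm1 : `|a - S m| < e / 4 by apply: h1; rewrite /= leq_maxl.
have hm2 : `|z ^+ m| < e / 4.
  apply: le_lt_trans (norm_exp_half _ hz) _; apply: le_lt_trans h2.
  by rewrite ler_wiXn2l ?leq_maxr ?invr_ge0 ?invf_le1 // ler1n.
have hz2 : `|1 - z| <= 2.
  apply: le_trans (ler_normB _ _) _; rewrite -[leRHS]/(1 + 1).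
  apply: lerD; first exact: norm_one_le1.
  by apply: le_trans hz _; rewrite invf_le1 // ler1n.
suff : e < e by rewrite ltxx.
have e34 : e / 4 * 2 + e / 4 < e.
  by rewrite [ltRHS](_ : e = e / 4 * 2 + e / 4 + e / 4) ?ltrDl //; field.
apply: lt_trans e34.
have eE : e = `|(a - S m) * (1 - z) - z ^+ m|.
  by rewrite mulrBl Sz opprB addrA addrAC addrK.
apply: (@le_lt_trans _ _ (`|a - S m| * 2 + `|z ^+ m|)).
  rewrite eE; apply: le_trans (ler_normB _ _) _; rewrite lerD2r.
  apply: le_trans (calg_normM _ _) _; apply: ler_wpM2l => //; exact: normr_ge0.
by apply: ler_ltD => //; rewrite ler_pM2r // ltW.
Qed.
End Neumann.

(** * Polynomials in the generators and their closure *)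

Section Algebraic.
Variables (R : realType) (D : idomainType).
Hypothesis D_not_field : ~ GRing.field_axiom D.
Hypothesis D_finite_quotients :
  forall m : D, m != 0 -> finite_set (residue_classes m).
Variables (A : cstarAlgType R) (s u : D -> A).
Hypothesis rel : ring_cstar_relations s u.
Local Notation v := (mono s u).
Local Notation K := R[i].

Definition mono_span (x : A) := exists2 l : seq (K * (D * D)),
  forall t, t \in l -> t.2.2 != 0 & x = \sum_(t <- l) t.1 *: v t.2.

Lemma mono_span0 : mono_span 0.
Proof. by exists [::] => //; rewrite big_nil. Qed.

Lemma mono_spanD x y : mono_span x -> mono_span y -> mono_span (x + y).
Proof.
move=> [l l0 ->] [l' l'0 ->]; exists (l ++ l'); last by rewrite big_cat.
by move=> t; rewrite mem_cat => /orP[/l0|/l'0].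
Qed.

Lemma mono_spanZ (c : K) p : p.2 != 0 -> mono_span (c *: v p).
Proof.
by move=> p0; exists [:: (c, p)]; rewrite ?big_seq1 // => t; rewrite inE => /eqP ->.
Qed.

Lemma mono_span_sum (I : eqType) (r : seq I) (F : I -> A) :
  (forall i, i \in r -> mono_span (F i)) -> mono_span (\sum_(i <- r) F i).
Proof.
move=> h; rewrite big_seq; apply: big_ind => //; first exact: mono_span0.
by move=> x y; exact: mono_spanD.
Qed.

Lemma mono_span_scale (c : K) x : mono_span x -> mono_span (c *: x).
Proof.
move=> [l l0 ->]; rewrite scaler_sumr; apply: mono_span_sum => t /l0 t0.
by rewrite scalerA; exact: mono_spanZ.
Qed.

Lemma mono_span_mulr x p : p.2 != 0 -> mono_span x -> mono_span (x * v p).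
Proof.
move=> p0 [l l0 ->]; rewrite mulr_suml; apply: mono_span_sum => t /l0 t0.
by rewrite mul_scalel (monoM rel) //; apply: mono_spanZ; rewrite mulf_neq0.
Qed.

(** Unlike the existence of a normal form, this property passes to products without
    any computation.  The level M can be raised to each of its nonzero multiples, so
    that two elements have a common level. *)
Definition locally_mono (y : A) := exists2 M : D, M != 0 &
  forall b, mono_span (y * v (b, M)).

Lemma mono_factor b (M k : D) : M != 0 -> k != 0 -> v (b, M * k) = v (b, M) * v (0, k).
Proof. by move=> M0 k0; rewrite (monoM rel) // /pmul /= mulr0 addr0. Qed.

Lemma locally_monoD x y : locally_mono x -> locally_mono y -> locally_mono (x + y).
Proof.
move=> [M M0 hM] [M' M'0 hM']; exists (M * M'); first exact: mulf_neq0.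
move=> b; rewrite mulrDl; apply: mono_spanD.
  by rewrite mono_factor // mulrA; exact: mono_span_mulr.
by rewrite [M * _]mulrC mono_factor // mulrA; exact: mono_span_mulr.
Qed.

Lemma locally_monoZ (c : K) x : locally_mono x -> locally_mono (c *: x).
Proof.
move=> [M M0 hM]; exists M => // b.
by rewrite mul_scalel; exact: mono_span_scale.
Qed.

Lemma locally_monoM x y : locally_mono x -> locally_mono y -> locally_mono (x * y).
Proof.
move=> [M M0 hM] [M' M'0 hM']; exists (M' * M); first exact: mulf_neq0.
move=> b; rewrite mono_factor // mulrA -(mulrA x); have [l l0 ->] := hM' b.
rewrite mulr_sumr mulr_suml; apply: mono_span_sum => t /l0 t0.
rewrite mul_scaler mul_scalel; apply: mono_span_scale.
rewrite -mulrA (monoM rel) // /pmul /= mulr0 addr0 [_ * M]mulrC mono_factor // mulrA.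
exact: mono_span_mulr.
Qed.

Lemma locally_mono_mono p : p.2 != 0 -> locally_mono (v p).
Proof.
move=> p0; exists 1; first exact: oner_neq0.
move=> b; rewrite -[v _]scale1r; apply: mono_span_mulr; first exact: oner_neq0.
exact: mono_spanZ.
Qed.

Lemma locally_mono_star_mono p : p.2 != 0 -> locally_mono (star (v p)).
Proof.
case: p => a m /= m0; exists m => // b.
have [[z ->]|nz] := pselect (exists z, b = a + m * z).
  rewrite (_ : v (a + m * z, m) = v (a, m) * v (z, 1)); last first.
    by rewrite (monoM rel) ?oner_neq0 // /pmul /= mulr1.
  rewrite mulrA (mono_isometry rel) // mul1r -[v _]scale1r.
  by apply: mono_spanZ; exact: oner_neq0.
rewrite (mono_orth D_finite_quotients rel) //; first exact: mono_span0.
move=> z e; apply: nz; exists (- z).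
by rewrite e mulrN addrK.
Qed.

(** Insert 1 = sum_b v(b, M) v(b, M)^*, b running through the residues modulo M. *)
Lemma locally_mono_normal_form y : locally_mono y ->
  exists M, exists2 L, M != 0 /\ (forall l, l \in L -> l.1.2.2 != 0) &
    y = normal_form s u M L.
Proof.
move=> [M M0 hM]; exists M.
pose P x := exists2 L : seq (K * (D * D) * D), forall l, l \in L -> l.1.2.2 != 0 &
  x = normal_form s u M L.
suff [L L0 e] : P y by exists L.
rewrite -[y]mulr1 -(sum_reps D_finite_quotients rel M0) mulr_sumr.
apply: (big_ind P).
- by exists [::] => //; rewrite /normal_form big_nil.
- move=> x x' [L L0 ->] [L' L'0 ->]; exists (L ++ L'); last by rewrite /normal_form big_cat.
  by move=> t; rewrite mem_cat => /orP[/L0|/L'0].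
move=> b _; rewrite mulrA; have [l l0 ->] := hM b.
exists [seq (t, b) | t <- l]; first by move=> _ /mapP[t /l0 t0 ->].
rewrite /normal_form big_map mulr_suml; apply: eq_bigr => t _.
by rewrite mul_scalel.
Qed.

Definition algebraic (y : A) := locally_mono y /\ locally_mono (star y).

Definition approximable (x : A) :=
  forall e : K, 0 < e -> exists2 y, algebraic y & `|x - y| < e.

(** If |x - y| < |x| / 32, then lambda >= |y|^2 / 4 >= (31/32)^2 |x|^2 / 4, whereas
    |x^* x - y^* y| <= |x - y| (|x| + |y|) <= (1/32) (65/32) |x|^2 <= lambda / 2.
    Hence W^* x^* x W = lambda (1 - z) with |z| <= 1/2. *)
Lemma approximable_invertible x : approximable x -> x != 0 ->
  exists a b : A, a * x * b = 1.
Proof.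
move=> hx x0; have n0 : 0 < `|x| by rewrite normr_gt0.
have [y [/locally_mono_normal_form[M [L [M0 L0] yE]] _] xy] :=
  hx (`|x| / 32) (divr_gt0 n0 (ltr0Sn K 31)).
have [W [la [WW yW] [la0 yla]]] :=
  exists_compressing_isometry D_not_field D_finite_quotients rel M0 L0.
rewrite -yE in yW yla.
have diff : `|star x * x - star y * y| <= `|x - y| * (`|x| + `|y|).
  rewrite (_ : _ - _ = star x * (x - y) + star (x - y) * y); last first.
    by rewrite starB mulrBr mulrBl addrA subrK.
  apply: le_trans (ler_normD _ _) _; rewrite [leRHS]mulrDr.
  apply: lerD; apply: le_trans (calg_normM _ _) _; rewrite norm_star //.
  by rewrite mulrC.
have yx : `|x| <= `|y| + `|x - y|.
  by rewrite -{1}(subrKC y x); exact: ler_normD.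
have yx' : `|y| <= `|x| + `|x - y|.
  by rewrite distrC -{1}(subrKC x y); exact: ler_normD.
have [la_gt0 small] : 0 < la /\ `|x - y| * (`|x| + `|y|) <= la / 2.
  have [nx nx0 ex] := ge0_complexP (normr_ge0 x).
  have [ny ny0 ey] := ge0_complexP (normr_ge0 y).
  have [nd nd0 ed] := ge0_complexP (normr_ge0 (x - y)).
  have [l l0 el] := ge0_complexP la0.
  move: n0 xy yla yx yx'; rewrite ex ey ed el.
  rewrite -[32](rmorph_nat (real_complex R)) -[4](rmorph_nat (real_complex R)).
  rewrite -[2](rmorph_nat (real_complex R)) -!fmorphV -!rmorphXn -!rmorphM -!rmorphD.
  rewrite -!rmorphM !ltcR !lecR => n0 xy yla yx yx'.
  have h1 : 31 / 32 * nx <= ny by lra.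
  have h2 : (31 / 32 * nx) ^+ 2 <= 4 * l.
    by apply: le_trans yla; rewrite ler_sqr ?nnegrE //; lra.
  have h3 : 0 < nx ^+ 2 by rewrite exprn_gt0.
  have h4 : nd * (nx + ny) <= nx / 32 * (65 / 32 * nx).
    by apply: ler_pM; lra.
  by split; nra.
pose z := la^-1 *: (star W * (star y * y - star x * x) * W).
have la_neq0 : la != 0 by rewrite gt_eqF.
have hz : `|z| <= 2^-1.
  rewrite normrZ normfV ger0_norm // ler_pdivrMl //.
  apply: le_trans (_ : `|star y * y - star x * x| <= _); last first.
    by rewrite distrC; apply: le_trans diff _.
  apply: le_trans (calg_normM _ _) _.
  rewrite -[leRHS]mulr1; apply: ler_pM => //; last exact: norm_isometry.
  apply: le_trans (calg_normM _ _) _; rewrite norm_star.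
  by rewrite -[leRHS]mul1r; apply: ler_pM => //; exact: norm_isometry.
have [a ha] := left_inverse_near1 hz.
exists (la^-1 *: (a * star W * star x)), W.
rewrite -[RHS]ha !mul_scalel -!mulrA -mul_scaler; congr (_ * _).
rewrite /z mulrBr mulrBl scalerBr opprB.
have -> : la^-1 *: (star W * (star y * y) * W) = 1.
  by rewrite !mulrA -mulrA -starM yW scalerA mulVf // scale1r.
by rewrite addrC subrK !mulrA.
Qed.

End Algebraic.

(** * Generation from universality *)

Record is_cstar_subalgebra (R : realType) (A : cstarAlgType R) (S : set A) := {
  sub1 : S 1;
  subD : forall x y, S x -> S y -> S (x + y);
  subZ : forall (a : R[i]) x, S x -> S (a *: x);
  subM : forall x y, S x -> S y -> S (x * y);
  sub_star : forall x, S x -> S (star x);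
  sub_limit : forall x, (forall e : R[i], 0 < e -> exists2 y, S y & `|x - y| < e) ->
    S x
}.

Section Subalgebra.
Variables (R : realType) (A : cstarAlgType R) (S : set A).
Hypothesis subS : is_cstar_subalgebra S.

(** The proof that S is a subalgebra is a parameter of the type, so that the instances
    below can depend on it. *)
Definition subalg (_ : is_cstar_subalgebra S) : Type := {x : A | x \in S}.
Local Notation T := (subalg subS).

HB.instance Definition _ := [isSub of T for @proj1_sig _ _].
HB.instance Definition _ := [Choice of T by <:].

Definition insubalg x (h : S x) : T := exist _ x (mem_set h).

Lemma subalgP (x : T) : S (val x).
Proof. exact: set_mem (valP x). Qed.

Lemma sub0 : S 0.
Proof. by rewrite -(scale0r (1 : A)); apply: (subZ subS); exact: sub1 subS. Qed.

Lemma subN x : S x -> S (- x).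
Proof. by rewrite -scaleN1r; exact: (subZ subS). Qed.

Let zero : T := insubalg sub0.
Let add (x y : T) : T := insubalg (subD subS (subalgP x) (subalgP y)).
Let opp (x : T) : T := insubalg (subN (subalgP x)).
Let scale (a : R[i]) (x : T) : T := insubalg (subZ subS a (subalgP x)).

Let addA : associative add. Proof. by move=> x y z; apply: val_inj; exact: addrA. Qed.
Let addC : commutative add. Proof. by move=> x y; apply: val_inj; exact: addrC. Qed.
Let add0 : left_id zero add. Proof. by move=> x; apply: val_inj; exact: add0r. Qed.
Let addN : left_inverse zero opp add.
Proof. by move=> x; apply: val_inj; exact: addNr. Qed.

HB.instance Definition _ := GRing.isZmodule.Build T addA addC add0 addN.

Let scaleA (a b : R[i]) (x : T) : scale a (scale b x) = scale (a * b) x.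
Proof. by apply: val_inj; exact: scalerA. Qed.
Let scale1 : left_id 1 scale.
Proof. by move=> x; apply: val_inj; exact: scale1r. Qed.
Let scaleDr : right_distributive scale +%R.
Proof. by move=> a x y; apply: val_inj; exact: scalerDr. Qed.
Let scaleDl (x : T) : {morph scale^~ x : a b / a + b}.
Proof. by move=> a b; apply: val_inj; exact: scalerDl. Qed.

HB.instance Definition _ := GRing.Zmodule_isLmodule.Build R[i] T scaleA scale1 scaleDr scaleDl.

Let norm (x : T) : R[i] := `|val x|.
Let normD (x y : T) : norm (x + y) <= norm x + norm y.
Proof. exact: ler_normD. Qed.
Let normZ (a : R[i]) (x : T) : norm (a *: x) = `|a| * norm x.
Proof. exact: normrZ. Qed.
Let norm0 (x : T) : norm x = 0 -> x = 0.
Proof. by move=> h; apply: val_inj; exact: normr0_eq0. Qed.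

HB.instance Definition _ := Lmodule_isNormed.Build R[i] T normD normZ norm0.

Let complete (F : set_system T) : ProperFilter F -> cauchy F -> cvg F.
Proof.
move=> FF Fc; have : cvg (val @ F).
  apply: cauchy_cvg; apply: cauchy_exP => e e0.
  have [x Fx] := proj1 (cauchyP _) Fc e e0.
  exists (val x).
  have sub : ball x e `<=` [set y : T | ball (val x) e (val y)].
    by move=> y; rewrite -!ball_normE.
  exact: filterS sub Fx.
set l := lim (val @ F) => Fl.
have near_l (e : R[i]) : 0 < e -> F [set y : T | `|l - val y| < e].
  move=> e0; exact: (proj1 (cvgrPdist_lt val l) Fl e e0).
have Sl : S l.
  apply: (sub_limit subS) => e e0; have [y hy] := filter_ex (near_l e e0).
  by exists (val y) => //; exact: subalgP.
apply/cvg_ex; exists (insubalg Sl); apply/cvg_ballP => e e0.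
by apply: filterS (near_l e e0) => y; rewrite -ball_normE.
Qed.

HB.instance Definition _ := Uniform_isComplete.Build T complete.

Definition subalg_cstar : cstarAlgType R.
refine (@CStarAlgType R (T : completeNormedModType R[i]) (insubalg (sub1 subS))
  (fun x y => insubalg (subM subS (subalgP x) (subalgP y)))
  (fun x => insubalg (sub_star subS (subalgP x))) _ _ _ _ _ _ _ _ _ _ _ _ _).
- by move=> x y z; apply: val_inj; exact: mulrA.
- by move=> x; apply: val_inj; exact: mul1r.
- by move=> x; apply: val_inj; exact: mulr1.
- by move=> x y z; apply: val_inj; exact: mulrDl.
- by move=> x y z; apply: val_inj; exact: mulrDr.
- by move=> a x y; apply: val_inj; exact: calg_scalerAl.
- by move=> a x y; apply: val_inj; exact: calg_scalerAr.
- by move=> x; apply: val_inj; exact: starK.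
- by move=> x y; apply: val_inj; exact: starD.
- by move=> a x; apply: val_inj; exact: starZ.
- by move=> x y; apply: val_inj; exact: starM.
- by move=> x y; exact: calg_normM.
- by move=> x; exact: calg_norm_starM.
Defined.

End Subalgebra.

Section Generation.
Variables (R : realType) (D : idomainType).
Hypothesis D_not_field : ~ GRing.field_axiom D.
Hypothesis D_finite_quotients :
  forall m : D, m != 0 -> finite_set (residue_classes m).
Variables (A : cstarAlgType R) (s u : D -> A).
Hypothesis rel : ring_cstar_relations s u.
Local Notation v := (mono s u).
Local Notation K := R[i].

Lemma algebraicD x y : algebraic s u x -> algebraic s u y -> algebraic s u (x + y).
Proof.
move=> [hx hx'] [hy hy']; split; first exact: (locally_monoD rel).
by rewrite starD; exact: (locally_monoD rel).
Qed.

Lemma algebraicZ (c : K) x : algebraic s u x -> algebraic s u (c *: x).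
Proof. by move=> [hx hx']; split; rewrite ?starZ; exact: locally_monoZ. Qed.

Lemma algebraicM x y : algebraic s u x -> algebraic s u y -> algebraic s u (x * y).
Proof.
by move=> [hx hx'] [hy hy']; split; rewrite ?starM; exact: (locally_monoM rel).
Qed.

Lemma algebraic_star x : algebraic s u x -> algebraic s u (star x).
Proof. by move=> [hx hx']; split; rewrite ?starK. Qed.

Lemma algebraic_mono p : p.2 != 0 -> algebraic s u (v p).
Proof.
move=> p0; split; first exact: (locally_mono_mono rel).
exact: (locally_mono_star_mono D_finite_quotients rel).
Qed.

Lemma algebraic_approximable x : algebraic s u x -> approximable s u x.
Proof. by move=> hx e e0; exists x; rewrite ?subrr ?normr0. Qed.

Lemma approximable_subalgebra : is_cstar_subalgebra (approximable s u).
Proof.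
split.
- apply: algebraic_approximable; rewrite -(s1 rel) -[s 1]mul1r -(u0 rel).
  by apply: (@algebraic_mono (0, 1)); exact: oner_neq0.
- move=> x y hx hy e e0; have e20 : 0 < e / 2 by rewrite divr_gt0.
  have [x' ax xx] := hx _ e20; have [y' ay yy] := hy _ e20.
  exists (x' + y'); first exact: algebraicD.
  rewrite opprD addrACA (splitr e); apply: le_lt_trans (ler_normD _ _) _.
  exact: ltrD.
- move=> a x hx e e0; have a0 : 0 < `|a| + 1 by rewrite ltr_wpDl.
  have [x' ax xx] := hx _ (divr_gt0 e0 a0).
  exists (a *: x'); first exact: algebraicZ.
  rewrite -scalerBr normrZ; apply: le_lt_trans (_ : (`|a| + 1) * `|x - x'| < e).
    by rewrite ler_wpM2r // lerDl.
  by rewrite mulrC -ltr_pdivlMr.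
- move=> x y hx hy e e0.
  have y0 : 0 < `|y| + 1 by rewrite ltr_wpDl.
  have [x' ax xx] := hx _ (divr_gt0 (divr_gt0 e0 (ltr0Sn K 1)) y0).
  have x0 : 0 < `|x'| + 1 by rewrite ltr_wpDl.
  have [y' ay yy] := hy _ (divr_gt0 (divr_gt0 e0 (ltr0Sn K 1)) x0).
  exists (x' * y'); first exact: algebraicM.
  rewrite (_ : x * y - _ = (x - x') * y + x' * (y - y')); last first.
    by rewrite mulrBl mulrBr addrA subrK.
  rewrite (splitr e); apply: le_lt_trans (ler_normD _ _) _; apply: ltrD.
    apply: le_lt_trans (calg_normM _ _) _.
    apply: le_lt_trans (_ : `|x - x'| * (`|y| + 1) < _).
      by rewrite ler_wpM2l // lerDl.
    by rewrite -ltr_pdivlMr.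
  apply: le_lt_trans (calg_normM _ _) _.
  apply: le_lt_trans (_ : (`|x'| + 1) * `|y - y'| < _).
    by rewrite ler_wpM2r // lerDl.
  by rewrite mulrC -ltr_pdivlMr.
- move=> x hx e e0; have [x' ax xx] := hx e e0.
  by exists (star x'); [exact: algebraic_star|rewrite -starB norm_star].
- move=> x hx e e0; have e20 : 0 < e / 2 by rewrite divr_gt0.
  have [y hy xy] := hx _ e20; have [z az yz] := hy _ e20.
  exists z => //; rewrite -(subrK y x) -addrA (splitr e).
  apply: le_lt_trans (ler_normD _ _) _; exact: ltrD.
Qed.

Let B := subalg_cstar approximable_subalgebra.

Let s_in m : m != 0 -> approximable s u (s m).
Proof.
move=> m0; apply: algebraic_approximable; rewrite -[s m]mul1r -(u0 rel).
exact: (@algebraic_mono (0, m)).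
Qed.

Let u_in n : approximable s u (u n).
Proof.
apply: algebraic_approximable; rewrite -(mono_u rel).
by apply: algebraic_mono; exact: oner_neq0.
Qed.

(* s 0 is arbitrary and may lie outside the subalgebra. *)
Let sB (m : D) : B :=
  if pselect (m != 0) is left m0 then insubalg approximable_subalgebra (s_in m0) else 0.
Let uB (n : D) : B := insubalg approximable_subalgebra (u_in n).

Let val_sB m : m != 0 -> val (sB m) = s m.
Proof. by rewrite /sB; case: pselect. Qed.

Let subalg_relations : ring_cstar_relations sB uB.
Proof.
split.
- move=> m m0; apply: val_inj; rewrite -[RHS](s_isometry rel m0).
  by rewrite -[in RHS](val_sB m0).
- by move=> n; apply: val_inj; exact: u_unitaryl rel n.
- by move=> n; apply: val_inj; exact: u_unitaryr rel n.
- move=> k m k0 m0; apply: val_inj.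
  rewrite -[RHS]/(val (sB (k * m))) val_sB ?mulf_neq0 // -(s_mul rel k0 m0).
  by rewrite -(val_sB k0) -(val_sB m0).
- by move=> l n; apply: val_inj; exact: u_add rel l n.
- move=> m n m0; apply: val_inj; have := s_u_comm rel n m0.
  by rewrite -(val_sB m0).
move=> m m0; rewrite fsbig_finite ?[X in X = _]/=; last exact: D_finite_quotients.
apply: val_inj; rewrite -[RHS](sum_range_proj rel m0) fsbig_finite; last first.
  exact: D_finite_quotients.
rewrite (big_morph val (id1 := 0) (op1 := +%R)) //.
by apply: eq_bigr => c _; rewrite /range_proj -(val_sB m0).
Qed.

(** The C*-subalgebra B of approximable elements satisfies the relations, so there is
    f : A -> B respecting the generators.  Followed by the inclusion of B it is, by
    uniqueness, the identity of A. *)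
Lemma universal_generated : is_universal_ring_cstar s u ->
  forall x, approximable s u x.
Proof.
move=> [_ univ] x.
have [f [[fD fZ fM f1 fstar] fs fu] _] := univ B sB uB subalg_relations.
have [g hg g_uniq] := univ A s u rel.
have val_f : maps_generators s u s u (fun y : A => val (f y)).
  split; last by move=> n; rewrite fu.
    split.
    - by move=> y z; rewrite fD.
    - by move=> a y; rewrite fZ.
    - by move=> y z; rewrite fM.
    - by rewrite f1.
    - by move=> y; rewrite fstar.
  by move=> m m0; rewrite fs // val_sB.
have id_f : maps_generators s u s u (@idfun A) by split.
have -> : x = val (f x) by rewrite (g_uniq _ val_f x) -(g_uniq _ id_f x).
exact: subalgP.
Qed.

End Generation.

(** * Unordered sums of complex families *)

Section ComplexComplete.
Variable R : realType.
Local Notation K := R[i].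

Lemma normcR (x : R) : `|x%:C| = `|x|%:C.
Proof. by rewrite normc_def /= expr0n /= addr0 sqrtr_sqr. Qed.

Lemma normr_Re_le (z : K) : `|complex.Re z|%:C <= `|z|.
Proof.
case: z => a b; rewrite normc_def lecR /= -sqrtr_sqr ler_wsqrtr //.
by rewrite lerDl sqr_ge0.
Qed.

Lemma normr_Im_le (z : K) : `|complex.Im z|%:C <= `|z|.
Proof.
case: z => a b; rewrite normc_def lecR /= -sqrtr_sqr ler_wsqrtr //.
by rewrite lerDr sqr_ge0.
Qed.

Lemma normr_le_ReIm (a b : R) : `|a +i* b| <= (`|a| + `|b|)%:C.
Proof.
rewrite (_ : a +i* b = a%:C + 'i * b%:C); last first.
  by rewrite -complexiE; simpc.
apply: le_trans (ler_normD _ _) _; rewrite rmorphD /= normrM normCi mul1r.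
by rewrite !normcR.
Qed.

(** Real and imaginary parts form Cauchy filters. *)
Lemma complex_complete (F : set_system K) : ProperFilter F ->
  (forall e : K, 0 < e -> exists z, F [set y | `|z - y| < e]) ->
  exists l : K, forall e : K, 0 < e -> F [set y | `|l - y| < e].
Proof.
move=> FF Fc.
have part (f : K -> R) : (forall z, `|f z|%:C <= `|z|) -> (forall x y, f (x - y) = f x - f y) ->
    exists l : R, forall e : R, 0 < e -> F [set z | `|l - f z| < e].
  move=> f_le fB; have : cvg (f @ F).
    apply: cauchy_cvg; apply: cauchy_exP => e e0.
    have [|z Fz] := Fc e%:C; first by rewrite ltcR.
    exists (f z); have sub : [set y | `|z - y| < e%:C] `<=` [set y | ball (f z) e (f y)].
      move=> y /= h; rewrite -ball_normE /= -fB -ltcR.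
      by apply: le_lt_trans h; exact: f_le.
    exact: filterS sub Fz.
  set l := lim (f @ F) => Fl; exists l => e e0.
  exact: (proj1 (cvgrPdist_lt f l) Fl e e0).
have [a ha] := part (@complex.Re R) normr_Re_le (fun x y => raddfB _ x y).
have [b hb] := part (@complex.Im R) normr_Im_le (fun x y => raddfB _ x y).
exists (a +i* b) => e e0; have [r _ er] := ge0_complexP (ltW e0).
have r0 : 0 < r / 2 by rewrite divr_gt0 // -ltcR -er.
apply: filterS (filterI (ha _ r0) (hb _ r0)) => -[x y] /= [hx hy].
apply: le_lt_trans (normr_le_ReIm (a - x) (b - y)) _.
by rewrite er ltcR (splitr r) ltrD.
Qed.
End ComplexComplete.

Lemma le_add_eps (R : realType) (a b : R[i]) : 0 <= a -> 0 <= b ->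
  (forall e : R[i], 0 < e -> a <= e + b) -> a <= b.
Proof.
move=> /ge0_complexP[r _ ->] /ge0_complexP[t _ ->] h; rewrite lecR.
by apply/ler_addgt0Pl => e e0; have := h e%:C; rewrite ltcR -rmorphD lecR; apply.
Qed.

Section Families.
Variables (R : realType) (I : choiceType).
Local Notation K := R[i].
Implicit Types (f g : I -> K) (F G H : {fset I}).

Lemma sum_fsetU (V : nmodType) (f : I -> V) F G : [disjoint F & G]%fset ->
  \sum_(i <- (F `|` G)%fset) f i = \sum_(i <- F) f i + \sum_(i <- G) f i.
Proof.
move=> FG; rewrite -big_cat; apply: perm_big; apply: uniq_perm.
- exact: fset_uniq.
- rewrite cat_uniq !fset_uniq andbT /=; apply/hasPn => i iG.
  exact: (fdisjointP_sym FG).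
- by move=> i; rewrite mem_cat in_fsetU.
Qed.

Lemma sum_fsetD (V : nmodType) (f : I -> V) F G : (F `<=` G)%fset ->
  \sum_(i <- G) f i = \sum_(i <- F) f i + \sum_(i <- (G `\` F)%fset) f i.
Proof.
move=> FG; rewrite -sum_fsetU; last by apply/fdisjointP => i iF; rewrite in_fsetD iF.
congr (\sum_(i <- enum_fset _) _); apply/fsetP => i; rewrite in_fsetU in_fsetD.
by have /fsubsetP /(_ i) := FG; case: (i \in F) => // ->.
Qed.

Definition has_sum f (l : K) := forall e : K, 0 < e ->
  exists F, forall G, (F `<=` G)%fset -> `|l - \sum_(i <- G) f i| <= e.

Lemma has_sum_ext f g l : f =1 g -> has_sum f l -> has_sum g l.
Proof. by move=> /funext ->. Qed.

Lemma has_sum_le f l F c b : has_sum f l ->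
  (forall G, (F `<=` G)%fset -> `|\sum_(i <- G) f i - c| <= b) -> `|l - c| <= b.
Proof.
move=> hf hb.
have h e : 0 < e -> `|l - c| <= e + b.
  move=> e0; have [G hG] := hf e e0.
  rewrite -(subrK (\sum_(i <- (F `|` G)%fset) f i) l) -addrA.
  apply: le_trans (ler_normD _ _) _; apply: lerD.
    by apply: hG; exact: fsubsetUr.
  by apply: hb; exact: fsubsetUl.
have b0 : 0 <= b by apply: le_trans (hb F (fsubset_refl _)); exact: normr_ge0.
exact: le_add_eps.
Qed.

Lemma has_sum_unique f l l' : has_sum f l -> has_sum f l' -> l = l'.
Proof.
move=> hl hl'; apply/eqP; rewrite -subr_eq0 -normr_le0.
have h (e : K) : 0 < e -> `|l - l'| <= e.
  move=> e0; have [F hF] := hl' e e0.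
  by apply: (has_sum_le (F := F) hl) => G FG; rewrite distrC; exact: hF.
by apply: le_add_eps => // e e0; rewrite addr0; exact: h.
Qed.

Lemma has_sumD f g l k : has_sum f l -> has_sum g k ->
  has_sum (fun i => f i + g i) (l + k).
Proof.
move=> hf hg e e0; have e20 : 0 < e / 2 by rewrite divr_gt0.
have [F hF] := hf _ e20; have [G hG] := hg _ e20.
exists (F `|` G)%fset => H; rewrite fsubUset => /andP[FH GH].
rewrite big_split /= opprD addrACA (splitr e).
by apply: le_trans (ler_normD _ _) _; apply: lerD; [exact: hF|exact: hG].
Qed.

Lemma has_sumZ (c : K) f l : has_sum f l -> has_sum (fun i => c * f i) (c * l).
Proof.
move=> hf e e0; have c0 : 0 < `|c| + 1 by rewrite ltr_wpDl.
have [F hF] := hf _ (divr_gt0 e0 c0); exists F => G FG.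
rewrite -mulr_sumr -mulrBr normrM; apply: le_trans (_ : (`|c| + 1) * (e / (`|c| + 1)) <= _).
  by apply: ler_pM => //; [rewrite lerDl|exact: hF].
by rewrite mulrC divfK ?gt_eqF.
Qed.

Lemma has_sum_conj f l : has_sum f l -> has_sum (fun i => Num.conj (f i)) (Num.conj l).
Proof.
move=> hf e e0; have [F hF] := hf e e0; exists F => G FG.
by rewrite -rmorph_sum -rmorphB norm_conjC; exact: hF.
Qed.

Lemma has_sum_sum (J : Type) (r : seq J) (f : J -> I -> K) (l : J -> K) :
  (forall j, has_sum (f j) (l j)) ->
  has_sum (fun i => \sum_(j <- r) f j i) (\sum_(j <- r) l j).
Proof.
move=> hf; elim: r => [|j r IH].
  move=> e e0; exists fset0 => G _; rewrite big_nil big1 ?subrr ?normr0 ?ltW // => i _.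
  by rewrite big_nil.
rewrite big_cons; apply: has_sum_ext (has_sumD (hf j) IH) => i.
by rewrite big_cons.
Qed.

Lemma has_sum1 f i0 : (forall i, i != i0 -> f i = 0) -> has_sum f (f i0).
Proof.
move=> f0 e e0; exists [fset i0]%fset => G; rewrite fsub1set => iG.
rewrite (big_fsetD1 i0) //= opprD addrA subrr sub0r normrN big_seq big1 ?normr0 ?ltW //.
by move=> i; rewrite in_fsetD1 => /andP[/f0].
Qed.

Definition square_bounded f (b : K) := forall F, \sum_(i <- F) `|f i| ^+ 2 <= b.

Lemma normM_le_squares (x y : K) : 2 * `|x * y| <= `|x| ^+ 2 + `|y| ^+ 2.
Proof.
rewrite normrM -subr_ge0 (_ : _ - _ = (`|x| - `|y|) ^+ 2); last by ring.
by rewrite real_exprn_even_ge0 // rpredB // normr_real.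
Qed.

Lemma square_bounded_tail f b e : square_bounded f b -> 0 < e ->
  exists F, forall G, [disjoint F & G]%fset -> \sum_(i <- G) `|f i| ^+ 2 <= e.
Proof.
move=> fb e0.
have sq_real F : exists2 r : R, 0 <= r & \sum_(i <- F) `|f i| ^+ 2 = r%:C.
  by apply: ge0_complexP; rewrite sumr_ge0 // => i _; rewrite exprn_ge0.
pose E := [set r : R | exists F, \sum_(i <- F) `|f i| ^+ 2 = r%:C].
have b0 : 0 <= b by apply: le_trans (fb fset0); rewrite big_nil.
have [b' _ eb] := ge0_complexP b0.
have E_sup : has_sup E.
  split; first by have [r _ hr] := sq_real fset0; exists r; exists fset0.
  by exists b' => r [F hF]; rewrite -lecR -hF -eb.
have [e' _ ee] := ge0_complexP (ltW e0); have e'0 : 0 < e' by rewrite -ltcR -ee.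
have [r [F hF] rE] := sup_adherent e'0 E_sup.
exists F => G FG.
have [t _ ht] := sq_real (F `|` G)%fset; have [g _ hg] := sq_real G.
have tE : t <= sup E by apply: sup_upper_bound => //; exists (F `|` G)%fset.
have : t%:C = r%:C + g%:C.
  by rewrite -ht -hF -hg sum_fsetU.
rewrite -rmorphD => /complexI tr; rewrite ee hg lecR.
by move: rE; rewrite -subr_gt0 => h; lra.
Qed.

(** The inequality of the means with a weight; choosing t replaces taking square roots
    in Cauchy-Schwarz estimates. *)
Lemma weighted_normM_le (t x y : K) : 0 < t ->
  2 * `|x * y| <= t * `|x| ^+ 2 + t^-1 * `|y| ^+ 2.
Proof.
move=> t0; rewrite normrM -subr_ge0.
rewrite (_ : _ - _ = t^-1 * (t * `|x| - `|y|) ^+ 2); last by field; rewrite gt_eqF.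
apply: mulr_ge0; first by rewrite invr_ge0 ltW.
rewrite real_exprn_even_ge0 // rpredB ?normr_real //.
by rewrite rpredM ?normr_real // gtr0_real.
Qed.

(** The uniformity in g is what allows the interchange of sums in the associativity
    of the matrix product.  With t = (b + 1) / e, the weighted inequality bounds twice
    the sum by t (e / t) + b / t <= 2 e. *)
Lemma uniform_tail f c b e : square_bounded f c -> 0 <= b -> 0 < e ->
  exists F, forall g G, square_bounded g b -> [disjoint F & G]%fset ->
    `|\sum_(i <- G) f i * g i| <= e.
Proof.
move=> fc b0 e0; have b1 : 0 < b + 1 by rewrite ltr_wpDl.
pose t := (b + 1) / e; have t0 : 0 < t by rewrite divr_gt0.
have [F hF] := square_bounded_tail fc (divr_gt0 e0 t0).
exists F => g G gb FG; rewrite -(ler_pM2l (_ : 0 < 2)) //.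
apply: le_trans (_ : t * (e / t) + t^-1 * b <= _).
  apply: le_trans (_ : \sum_(i <- G) (t * `|f i| ^+ 2 + t^-1 * `|g i| ^+ 2) <= _).
    rewrite -[2]gtr0_norm // -normrM mulr_sumr.
    apply: le_trans (ler_norm_sum _ _ _) _; apply: ler_sum => i _.
    by rewrite normrM gtr0_norm //; exact: weighted_normM_le.
  rewrite big_split /= -!mulr_sumr; apply: lerD.
    by rewrite ler_pM2l //; exact: hF.
  by rewrite ler_pM2l ?invr_gt0 //; exact: gb.
rewrite mulrC divfK ?gt_eqF // [2 * e]mulr_natl mulr2n lerD2l /t invf_div.
by rewrite mulrAC ler_pdivrMr // ler_pM2l // lerDl.
Qed.

Lemma has_sum_exists f g c b : square_bounded f c -> square_bounded g b ->
  exists l, has_sum (fun i => f i * g i) l.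
Proof.
move=> fc gb; have b0 : 0 <= b by apply: le_trans (gb fset0); rewrite big_nil.
pose S F := \sum_(i <- F) f i * g i.
pose FF : set_system {fset I} := filter_from setT (fun F => [set G | (F `<=` G)%fset]).
have FFF : ProperFilter FF.
  apply: filter_from_proper; last by move=> F _; exists F; exact: fsubset_refl.
  apply: filter_fromT_filter; first by exists fset0.
  by move=> F G; exists (F `|` G)%fset => H /=; rewrite fsubUset => /andP[].
have [e e0|l hl] := @complex_complete R (S @ FF) _.
  have e20 : 0 < e / 2 by rewrite divr_gt0.
  have [F hF] := uniform_tail fc b0 e20.
  exists (S F), F => // G /= FG; rewrite /S (sum_fsetD _ FG) opprD addNKr normrN.
  apply: le_lt_trans (hF g _ gb _) _; last by rewrite ltr_pdivrMr // ltr_pMr // ltr1n.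
  by apply/fdisjointP => i iF; rewrite in_fsetD iF.
exists l => e e0; have [F _ hF] := hl e e0.
by exists F => G FG; apply: ltW; exact: hF.
Qed.

Definition sumI f : K := xget 0 [set l | has_sum f l].

Lemma sumI_eq f l : has_sum f l -> sumI f = l.
Proof. by move=> h; apply: xget_unique => // k hk; exact: has_sum_unique hk h. Qed.

Lemma sumIP f l : has_sum f l -> has_sum f (sumI f).
Proof. by move=> h; rewrite (sumI_eq h). Qed.

Lemma has_sum_tail f c b e : square_bounded f c -> 0 <= b -> 0 < e ->
  exists F, forall g l, square_bounded g b -> has_sum (fun i => f i * g i) l ->
    `|l - \sum_(i <- F) f i * g i| <= e.
Proof.
move=> fc b0 e0; have [F hF] := uniform_tail fc b0 e0; exists F => g l gb hl.
apply: (has_sum_le (F := F) hl) => G FG.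
rewrite (sum_fsetD _ FG) addrC addKr; apply: hF => //.
by apply/fdisjointP => i iF; rewrite in_fsetD iF.
Qed.
End Families.

(** * Bounded infinite matrices *)

Section Matrices.
Variables (R : realType) (I : choiceType).
Local Notation K := R[i].
Local Notation mat := (I -> I -> K).
Implicit Types (T S U : mat) (F G H : {fset I}) (x y : I -> K) (C : K).

Definition sqnorm F x : K := \sum_(i <- F) `|x i| ^+ 2.

Definition form T F G x y : K :=
  \sum_(i <- F) \sum_(j <- G) Num.conj (x i) * T i j * y j.

(** By scaling x and y against each other this amounts to |<x, T y>| <= C |x| |y|, that
    is, to the operator norm being at most C, but it is free of square roots. *)
Definition bounded_by T C := forall F G x y,
  2 * `|form T F G x y| <= C * (sqnorm F x + sqnorm G y).

Lemma sqnorm_ge0 F x : 0 <= sqnorm F x.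
Proof. by rewrite sumr_ge0 // => i _; rewrite exprn_ge0. Qed.

Lemma sqnormZ F c x : sqnorm F (fun i => c * x i) = `|c| ^+ 2 * sqnorm F x.
Proof. by rewrite mulr_sumr; apply: eq_bigr => i _; rewrite normrM exprMn. Qed.

Lemma bounded_by_le T C C' : C <= C' -> bounded_by T C -> bounded_by T C'.
Proof.
move=> CC' h F G x y; apply: le_trans (h F G x y) _.
by rewrite ler_wpM2r // addr_ge0 // sqnorm_ge0.
Qed.

(** Test the form on x = C^-1 T y. *)
Lemma bounded_apply T C F G y : 0 <= C -> bounded_by T C ->
  sqnorm F (fun i => \sum_(j <- G) T i j * y j) <= C ^+ 2 * sqnorm G y.
Proof.
move=> C0 hT; set z := fun i => _; set Y := sqnorm F z.
have formE t : t \is Num.real -> form T F G (fun i => t * z i) y = t * Y.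
  move=> tR; rewrite mulr_sumr; apply: eq_bigr => i _.
  transitivity (Num.conj (t * z i) * z i).
    rewrite -[RHS]/(_ * \sum_(j <- G) T i j * y j) mulr_sumr.
    by apply: eq_bigr => j _; rewrite mulrA.
  by rewrite rmorphM /= conj_Creal // -mulrA [_ * z i]mulrC -normCK.
have Y0 : 0 <= Y := sqnorm_ge0 _ _.
have [C_eq0|C_neq0] := eqVneq C 0.
  have := hT F G (fun i => 1 * z i) y.
  rewrite C_eq0 formE ?rpred1 // mul1r mul0r expr0n /= mul0r ger0_norm //.
  by rewrite pmulr_rle0.
have C_gt0 : 0 < C by rewrite lt_def C_neq0.
have := hT F G (fun i => C^-1 * z i) y.
rewrite formE ?rpredV ?ger0_real // ger0_norm ?mulr_ge0 ?invr_ge0 // sqnormZ -/Y.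
rewrite ger0_norm ?invr_ge0 // mulrDr [X in _ <= X + _](_ : _ = C^-1 * Y); last by field.
rewrite [2 * _]mulr_natl mulr2n lerD2l ler_pdivrMl // => h.
by apply: le_trans h _; rewrite mulrA expr2.
Qed.

Definition adjm T : mat := fun i j => Num.conj (T j i).

Lemma form_adj T F G x y : form (adjm T) F G x y = Num.conj (form T G F y x).
Proof.
rewrite /form rmorph_sum exchange_big; apply: eq_bigr => j _.
rewrite rmorph_sum; apply: eq_bigr => i _.
by rewrite !rmorphM /= conjCK /adjm; ring.
Qed.

Lemma bounded_adj T C : bounded_by T C -> bounded_by (adjm T) C.
Proof. by move=> h F G x y; rewrite form_adj norm_conjC addrC; exact: h. Qed.

Lemma adjmK T : adjm (adjm T) = T.
Proof. by apply/funext => i; apply/funext => j; rewrite /adjm conjCK. Qed.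

Lemma bounded_col T C k : 0 <= C -> bounded_by T C ->
  square_bounded (fun j => T j k) (C ^+ 2).
Proof.
move=> C0 hT F; have := bounded_apply F [fset k]%fset (fun _ => 1) C0 hT.
rewrite /sqnorm big_seq_fset1 normr1 expr1n mulr1; apply: le_trans.
by apply: ler_sum => i _; rewrite big_seq_fset1 mulr1.
Qed.

Lemma bounded_row T C i : 0 <= C -> bounded_by T C -> square_bounded (T i) (C ^+ 2).
Proof.
move=> C0 /bounded_adj hT F; apply: le_trans (bounded_col i C0 hT F).
by apply: ler_sum => j _; rewrite /adjm norm_conjC.
Qed.

Definition mulm T S : mat := fun i k => sumI (fun j => T i j * S j k).

Lemma mulmP T S C C' i k : 0 <= C -> 0 <= C' -> bounded_by T C -> bounded_by S C' ->
  has_sum (fun j => T i j * S j k) (mulm T S i k).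
Proof.
move=> C0 C'0 hT hS.
have [l hl] := has_sum_exists (bounded_row i C0 hT) (bounded_col k C'0 hS).
exact: sumIP hl.
Qed.

(** <x, T S y> = <T^* x, S y> is estimated with the weight t = C' / C, which makes both
    |T^* x|^2 and |S y|^2 contribute with the factor C C'. *)
Lemma bounded_mul T S C C' : 0 < C -> 0 < C' -> bounded_by T C -> bounded_by S C' ->
  bounded_by (mulm T S) (C * C').
Proof.
move=> C0 C'0 hT hS F G x y.
pose a j := \sum_(i <- F) Num.conj (x i) * T i j.
pose b j := \sum_(k <- G) S j k * y k.
have form_sum : has_sum (fun j => a j * b j) (form (mulm T S) F G x y).
  apply: has_sum_ext (_ : has_sum (fun j => \sum_(i <- F) \sum_(k <- G)
      (Num.conj (x i) * y k) * (T i j * S j k)) _).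
    move=> j; rewrite mulr_suml; apply: eq_bigr => i _.
    by rewrite /b mulr_sumr; apply: eq_bigr => k _; ring.
  rewrite /form; apply: has_sum_sum => i; apply: has_sum_sum => k.
  by rewrite mulrAC; apply: has_sumZ; apply: mulmP hT hS; exact: ltW.
rewrite mulrC -ler_pdivlMr // -[form _ _ _ _ _]subr0.
apply: (has_sum_le (F := fset0) form_sum) => H _; rewrite subr0.
rewrite ler_pdivlMr // mulrC; pose t := C' / C; have t0 : 0 < t by rewrite divr_gt0.
apply: le_trans (_ : \sum_(j <- H) (t * `|a j| ^+ 2 + t^-1 * `|b j| ^+ 2) <= _).
  rewrite -[2]gtr0_norm // -normrM mulr_sumr.
  apply: le_trans (ler_norm_sum _ _ _) _; apply: ler_sum => j _.
  by rewrite normrM gtr0_norm //; exact: weighted_normM_le.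
rewrite big_split /= -!mulr_sumr mulrDr; apply: lerD.
  have -> : \sum_(j <- H) `|a j| ^+ 2 =
      sqnorm H (fun j => \sum_(i <- F) adjm T j i * x i).
    apply: eq_bigr => j _; congr (_ ^+ 2); rewrite -norm_conjC rmorph_sum.
    by congr (`|_|); apply: eq_bigr => i _; rewrite rmorphM /= conjCK mulrC.
  apply: le_trans (_ : t * (C ^+ 2 * sqnorm F x) <= _).
    by rewrite ler_pM2l //; exact: bounded_apply (ltW C0) (bounded_adj hT).
  by rewrite mulrA (_ : t * C ^+ 2 = C * C') // /t; field; rewrite gt_eqF.
apply: le_trans (_ : t^-1 * (C' ^+ 2 * sqnorm G y) <= _).
  by rewrite ler_pM2l ?invr_gt0 //; exact: bounded_apply (ltW C'0) hS.
rewrite mulrA (_ : t^-1 * C' ^+ 2 = C * C') // /t invf_div; field.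
by rewrite gt_eqF.
Qed.

(** Up to e / 3 the summation over j may be restricted to one finite set F0,
    simultaneously for all partial sums over k, since these partial sums are uniformly
    square-summable in j.  A finite sum over j can be interchanged with the sum over k. *)
Lemma mulmA T S U C : 0 < C -> bounded_by T C -> bounded_by S C -> bounded_by U C ->
  mulm T (mulm S U) = mulm (mulm T S) U.
Proof.
move=> C0 hT hS hU; have C0' := ltW C0.
apply/funext => i; apply/funext => l; apply/esym/sumI_eq => e e0.
have e30 : 0 < e / 3 by rewrite divr_gt0.
have CC0 : 0 < C * C by rewrite mulr_gt0.
have [F0 hF0] := has_sum_tail (bounded_row i C0' hT) (exprn_ge0 2 (ltW CC0)) e30.
pose b := mulm T (mulm S U) i l.
have b_near : `|b - \sum_(j <- F0) T i j * mulm S U j l| <= e / 3.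
  apply: hF0; last exact: mulmP C0' (ltW CC0) hT (bounded_mul C0 C0 hS hU).
  exact: bounded_col (ltW CC0) (bounded_mul C0 C0 hS hU).
pose g H j := \sum_(k <- H) S j k * U k l.
have part_near H : `|\sum_(k <- H) mulm T S i k * U k l - \sum_(j <- F0) T i j * g H j| <= e / 3.
  apply: hF0 => [F|].
    apply: le_trans (bounded_apply F H (fun k => U k l) C0' hS) _.
    rewrite exprMn [leRHS]/= ler_pM2l ?exprn_gt0 //; exact: bounded_col C0' hU H.
  apply: has_sum_ext (_ : has_sum (fun j => \sum_(k <- H) U k l * (T i j * S j k)) _).
    by move=> j; rewrite /g mulr_sumr; apply: eq_bigr => k _; ring.
  apply: has_sum_sum => k; rewrite mulrC; apply: has_sumZ.
  exact: (mulmP _ _ C0' C0' hT hS).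
have inner : has_sum (fun k => \sum_(j <- F0) T i j * (S j k * U k l))
    (\sum_(j <- F0) T i j * mulm S U j l).
  by apply: has_sum_sum => j; apply: has_sumZ; exact: (mulmP _ _ C0' C0' hS hU).
have [K0 hK0] := inner _ e30; exists K0 => H KH.
have -> : e = e / 3 + e / 3 + e / 3 by field.
set P := \sum_(j <- F0) T i j * mulm S U j l in b_near inner hK0.
set Q := \sum_(j <- F0) T i j * g H j in part_near *.
have PQ : `|P - Q| <= e / 3.
  rewrite (_ : Q = \sum_(k <- H) \sum_(j <- F0) T i j * (S j k * U k l)); first exact: hK0.
  by rewrite /Q exchange_big; apply: eq_bigr => j _; rewrite /g mulr_sumr.
have := part_near H; rewrite -/Q distrC => QH.
rewrite (_ : mulm T (mulm S U) i l - _ = (b - P) + (P - Q) + (Q - \sum_(k <- H) mulm T S i k * U k l)); last first.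
  by rewrite /b; ring.
by apply: le_trans (ler_normD _ _) _; apply: lerD => //; apply: le_trans (ler_normD _ _) _; exact: lerD.
Qed.

Lemma adjmM T S C C' : 0 <= C -> 0 <= C' -> bounded_by T C -> bounded_by S C' ->
  adjm (mulm T S) = mulm (adjm S) (adjm T).
Proof.
move=> C0 C'0 hT hS; apply/funext => i; apply/funext => k; apply/esym/sumI_eq.
apply: has_sum_ext (has_sum_conj (mulmP k i C0 C'0 hT hS)) => j.
by rewrite rmorphM mulrC.
Qed.

(** The nontrivial half of the C*-identity: |T y|^2 = <y, T^* T y> <= c^2 |y|^2. *)
Lemma bounded_sqrt T C c : 0 <= C -> bounded_by T C -> 0 < c ->
  bounded_by (mulm (adjm T) T) (c ^+ 2) -> bounded_by T c.
Proof.
move=> C0 hT c0 hTT F G x y.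
pose z i := \sum_(j <- G) T i j * y j.
have zz : has_sum (fun i => `|z i| ^+ 2) (form (mulm (adjm T) T) G G y y).
  apply: has_sum_ext (_ : has_sum (fun i => \sum_(j <- G) \sum_(k <- G)
      (Num.conj (y j) * y k) * (adjm T j i * T i k)) _).
    move=> i; rewrite normCK /z mulrC rmorph_sum mulr_suml; apply: eq_bigr => j _.
    by rewrite mulr_sumr; apply: eq_bigr => k _; rewrite rmorphM /= /adjm; ring.
  rewrite /form; apply: has_sum_sum => j; apply: has_sum_sum => k.
  by rewrite mulrAC; apply: has_sumZ; exact: (mulmP _ _ C0 C0 (bounded_adj hT) hT).
have zF : sqnorm F z <= c ^+ 2 * sqnorm G y.
  set w := form _ _ _ _ _ in zz.
  have w_le : `|w| <= c ^+ 2 * sqnorm G y.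
    have := hTT G G y y; rewrite -/w; set q := sqnorm G y.
    have -> : c ^+ 2 * (q + q) = 2 * (c ^+ 2 * q) by ring.
    by rewrite ler_pM2l.
  apply: le_trans w_le.
  apply: le_add_eps => //; first exact: sqnorm_ge0.
  move=> e e0; have [K0 hK0] := zz e e0.
  apply: le_trans (_ : \sum_(i <- (K0 `|` F)%fset) `|z i| ^+ 2 <= _).
    by rewrite [leRHS](sum_fsetD _ (fsubsetUr K0 F)) lerDl sumr_ge0.
  have := hK0 _ (fsubsetUl K0 F); set sg := \sum_(i <- _) _ => hsg.
  have sg0 : 0 <= sg by rewrite sumr_ge0 // => i _; rewrite exprn_ge0.
  have : `|sg| <= `|w| + `|w - sg| by rewrite -{1}(subKr w sg); exact: ler_normB.
  by rewrite (ger0_norm sg0) => h; apply: le_trans h _; rewrite addrC lerD2r.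
have -> : form T F G x y = \sum_(i <- F) Num.conj (x i) * z i.
  apply: eq_bigr => i _; rewrite /z mulr_sumr; apply: eq_bigr => j _.
  by rewrite mulrA.
apply: le_trans (_ : \sum_(i <- F) (c * `|x i| ^+ 2 + c^-1 * `|z i| ^+ 2) <= _).
  rewrite -[2]gtr0_norm // -normrM mulr_sumr.
  apply: le_trans (ler_norm_sum _ _ _) _; apply: ler_sum => j _.
  rewrite normrM gtr0_norm //; apply: le_trans (weighted_normM_le _ _ c0) _.
  by rewrite norm_conjC.
rewrite big_split /= -!mulr_sumr mulrDr lerD2l.
apply: le_trans (_ : c^-1 * (c ^+ 2 * sqnorm G y) <= _).
  by rewrite ler_pM2l ?invr_gt0.
by rewrite mulrA expr2 mulKf // gt_eqF.
Qed.

Lemma form_lin (a : K) T S F G x y :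
  form (fun i j => a * T i j + S i j) F G x y = a * form T F G x y + form S F G x y.
Proof.
rewrite /form mulr_sumr -big_split; apply: eq_bigr => i _ /=.
by rewrite mulr_sumr -big_split; apply: eq_bigr => j _ /=; ring.
Qed.

Lemma bounded_lin (a : K) T S C C' : bounded_by T C -> bounded_by S C' ->
  bounded_by (fun i j => a * T i j + S i j) (`|a| * C + C').
Proof.
move=> hT hS F G x y; rewrite form_lin [leRHS]mulrDl.
apply: le_trans (_ : 2 * (`|a| * `|form T F G x y| + `|form S F G x y|) <= _).
  by rewrite ler_pM2l // -normrM; exact: ler_normD.
rewrite mulrDr mulrCA -mulrA; apply: lerD; last exact: hS.
by rewrite ler_wpM2l //; exact: hT.
Qed.

Lemma bounded_entry T C i j : bounded_by T C -> `|T i j| <= C.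
Proof.
move=> h; have := h [fset i]%fset [fset j]%fset (fun _ => 1) (fun _ => 1).
rewrite /form /sqnorm !big_seq_fset1 conjC1 mul1r mulr1 normr1 expr1n mulrC.
by rewrite ler_pM2r.
Qed.

Lemma bounded0 : bounded_by (fun _ _ => 0) 0.
Proof.
move=> F G x y; rewrite mul0r /form big1 ?normr0 ?mulr0 // => i _.
by rewrite big1 // => j _; rewrite mulr0 mul0r.
Qed.

Definition opnorm T : R := inf [set c : R | 0 <= c /\ bounded_by T c%:C].

Definition bounded T := exists2 C : K, 0 <= C & bounded_by T C.

Lemma opnorm_has_inf T : bounded T -> has_inf [set c : R | 0 <= c /\ bounded_by T c%:C].
Proof.
move=> [C C0]; have [c c0 ->] := ge0_complexP C0 => hc.
by split; [exists c|exists 0 => t [t0 _]].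
Qed.

Lemma opnorm_ge0 T : bounded T -> 0 <= opnorm T.
Proof.
move=> /opnorm_has_inf[ne _]; apply: lb_le_inf => //.
by move=> t [t0 _].
Qed.

Lemma opnorm_le T (c : R) : 0 <= c -> bounded_by T c%:C -> opnorm T <= c.
Proof.
by move=> c0 hc; apply: ge_inf; [exists 0 => t []|split].
Qed.

Lemma opnormP T : bounded T -> bounded_by T (opnorm T)%:C.
Proof.
move=> bT F G x y; set q := _ + _.
have q0 : 0 <= q by rewrite addr_ge0 // sqnorm_ge0.
have q1 : 0 < q + 1 by rewrite ltr_wpDl.
apply: le_add_eps => [||e e0].
- by rewrite mulr_ge0.
- by rewrite mulr_ge0 // -[0](rmorph0 (real_complex R)) lecR opnorm_ge0.
have [r _ er] := ge0_complexP (ltW (divr_gt0 e0 q1)).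
have r0 : 0 < r by rewrite -ltcR -er divr_gt0.
have [c [c0 hc] cr] := inf_adherent r0 (opnorm_has_inf bT).
apply: le_trans (hc F G x y) _; rewrite -/q.
apply: le_trans (_ : (opnorm T + r)%:C * q <= _); first by rewrite ler_wpM2r // lecR ltW.
rewrite rmorphD mulrDl addrC lerD2r /= -er.
by rewrite mulrAC ler_pdivrMr // ler_pM2l // lerDl.
Qed.

Lemma opnorm_eq0 T : bounded T -> opnorm T = 0 -> forall i j, T i j = 0.
Proof.
move=> bT T0 i j; apply/eqP; rewrite -normr_le0.
by have := bounded_entry i j (opnormP bT); rewrite T0.
Qed.
End Matrices.

(** * The C*-algebra of bounded matrices *)

Section MatrixAlgebra.
Variables (R : realType) (I : choiceType).
Local Notation K := R[i].

Record bmat := BMat { ent : I -> I -> K; ent_bounded : bounded ent }.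

Lemma bmat_eq (S T : bmat) : (forall i j, ent S i j = ent T i j) -> S = T.
Proof.
case: S T => [S hS] [T hT] /= h.
have ST : S = T by apply/funext => i; apply/funext.
by move: hS; rewrite ST => hS; rewrite (Prop_irrelevance hS hT).
Qed.

HB.instance Definition _ := gen_eqMixin bmat.
HB.instance Definition _ := gen_choiceMixin bmat.

Lemma bounded_const0 : bounded (fun _ _ : I => 0 : K).
Proof. by exists 0 => //; exact: bounded0. Qed.

Lemma bounded_comb (a : K) (T S : I -> I -> K) : bounded T -> bounded S ->
  bounded (fun i j => a * T i j + S i j).
Proof.
move=> [C C0 hT] [C' C'0 hS]; exists (`|a| * C + C'); last exact: bounded_lin.
by rewrite addr_ge0 // mulr_ge0.
Qed.

Let zero := BMat bounded_const0.

Lemma boundedD (T S : bmat) : bounded (fun i j => ent T i j + ent S i j).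
Proof.
have := bounded_comb 1 (ent_bounded T) (ent_bounded S); congr (bounded _).
by apply/funext => i; apply/funext => j; rewrite mul1r.
Qed.

Lemma boundedZ a (T : bmat) : bounded (fun i j => a * ent T i j).
Proof.
have := bounded_comb a (ent_bounded T) bounded_const0; congr (bounded _).
by apply/funext => i; apply/funext => j; rewrite addr0.
Qed.

Let add S T := BMat (boundedD S T).
Let scale a T := BMat (boundedZ a T).
Let opp T := scale (-1) T.

Let addA : associative add. Proof. by move=> *; apply: bmat_eq => i j; exact: addrA. Qed.
Let addC : commutative add. Proof. by move=> *; apply: bmat_eq => i j; exact: addrC. Qed.
Let add0 : left_id zero add. Proof. by move=> *; apply: bmat_eq => i j; exact: add0r. Qed.
Let addN : left_inverse zero opp add.
Proof. by move=> *; apply: bmat_eq => i j; rewrite /= mulN1r addNr. Qed.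

HB.instance Definition _ := GRing.isZmodule.Build bmat addA addC add0 addN.

Let scaleA (a b : K) (x : bmat) : scale a (scale b x) = scale (a * b) x.
Proof. by apply: bmat_eq => i j; exact: mulrA. Qed.
Let scale1 : left_id 1 scale.
Proof. by move=> x; apply: bmat_eq => i j; exact: mul1r. Qed.
Let scaleDr : right_distributive scale +%R.
Proof. by move=> a x y; apply: bmat_eq => i j; exact: mulrDr. Qed.
Let scaleDl (x : bmat) : {morph scale^~ x : a b / a + b}.
Proof. by move=> a b; apply: bmat_eq => i j; exact: mulrDl. Qed.

HB.instance Definition _ := GRing.Zmodule_isLmodule.Build K bmat scaleA scale1 scaleDr scaleDl.

Lemma entD (S T : bmat) i j : ent (S + T) i j = ent S i j + ent T i j. Proof. by []. Qed.
Lemma entB (S T : bmat) i j : ent (S - T) i j = ent S i j - ent T i j.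
Proof. by rewrite entD /= mulN1r. Qed.
Lemma ent_subE (S T : bmat) : ent (S - T) = fun i j => ent S i j - ent T i j.
Proof. by apply/funext => i; apply/funext => j; exact: entB. Qed.
Lemma ent_sum (J : Type) (r : seq J) (P : pred J) (F : J -> bmat) i j :
  ent (\sum_(k <- r | P k) F k) i j = \sum_(k <- r | P k) ent (F k) i j.
Proof. by apply: (big_morph (fun T => ent T i j)). Qed.

Let norm (T : bmat) : K := (opnorm (ent T))%:C.

Lemma normP (T : bmat) : bounded_by (ent T) (norm T).
Proof. exact: opnormP (ent_bounded T). Qed.

Lemma norm_ge0 (T : bmat) : 0 <= norm T.
Proof. by rewrite -[0](rmorph0 (real_complex R)) lecR opnorm_ge0 //; exact: ent_bounded. Qed.

Lemma norm_le (T : bmat) (C : K) : 0 <= C -> bounded_by (ent T) C -> norm T <= C.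
Proof. by move=> /ge0_complexP[c c0 ->] h; rewrite lecR; exact: opnorm_le. Qed.

Let normD (x y : bmat) : norm (x + y) <= norm x + norm y.
Proof.
apply: norm_le; first by rewrite addr_ge0 // norm_ge0.
have := bounded_lin 1 (normP x) (normP y); rewrite normr1 mul1r.
by congr (bounded_by _ _); apply/funext => i; apply/funext => j; rewrite mul1r.
Qed.

Let normZ_le (a : K) (x : bmat) : norm (a *: x) <= `|a| * norm x.
Proof.
apply: norm_le; first by rewrite mulr_ge0 // norm_ge0.
have := bounded_lin a (normP x) (@bounded0 R I); rewrite addr0.
by congr (bounded_by _ _); apply/funext => i; apply/funext => j; rewrite addr0.
Qed.

Let normZ (a : K) (x : bmat) : norm (a *: x) = `|a| * norm x.
Proof.
apply/le_anti; rewrite normZ_le /=.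
have [->|a0] := eqVneq a 0; first by rewrite normr0 mul0r norm_ge0.
have := normZ_le a^-1 (a *: x); rewrite scalerA mulVf // scale1r normfV.
by rewrite ler_pdivlMl ?normr_gt0.
Qed.

Let norm0 (x : bmat) : norm x = 0 -> x = 0.
Proof.
move=> /complexI h; apply: bmat_eq => i j.
exact: opnorm_eq0 (ent_bounded x) h i j.
Qed.

HB.instance Definition _ := Lmodule_isNormed.Build K bmat normD normZ norm0.

Lemma bounded_norm (T : bmat) : bounded_by (ent T) `|T|.
Proof. exact: normP. Qed.

Lemma bmat_norm_le (T : bmat) (C : K) : 0 <= C -> bounded_by (ent T) C -> `|T| <= C.
Proof. exact: norm_le. Qed.

(* Entries converge by completeness of the complex numbers, hence so do the forms on
   finite sets, and the bound on the differences passes to the limit form by form. *)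
Let complete (F : set_system bmat) : ProperFilter F -> cauchy F -> cvg F.
Proof.
move=> FF Fc.
have Fball (e : K) : 0 < e -> exists x, F [set y | `|x - y| < e].
  move=> e0; have [x Fx] := proj1 (cauchyP _) Fc e e0.
  by exists x; rewrite -ball_normE in Fx.
have entry_lim i j : exists l : K, forall e : K, 0 < e -> F [set y | `|l - ent y i j| < e].
  have [e e0|l hl] := @complex_complete R ((fun y => ent y i j) @ F) _; last by exists l.
  have [x Fx] := Fball e e0; exists (ent x i j).
  have sub : [set y | `|x - y| < e] `<=` [set y | `|ent x i j - ent y i j| < e].
    move=> y /=; apply: le_lt_trans; rewrite -entB.
    exact: bounded_entry (bounded_norm _).
  exact: filterS sub Fx.
have [l hl] : exists l : I -> I -> K, forall i j (e : K), 0 < e ->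
    F [set y | `|l i j - ent y i j| < e].
  by exists (fun i j => sval (cid (entry_lim i j))) => i j; case: (cid _).
pose conv (f : bmat -> K) (c : K) := forall e : K, 0 < e -> F [set y | `|c - f y| < e].
have convD f g a b : conv f a -> conv g b -> conv (fun y => f y + g y) (a + b).
  move=> hf hg e e0; have e20 : 0 < e / 2 by rewrite divr_gt0.
  apply: filterS (filterI (hf _ e20) (hg _ e20)) => y /= [h1 h2].
  by rewrite opprD addrACA (splitr e); apply: le_lt_trans (ler_normD _ _) _; exact: ltrD.
have convZ c f a : conv f a -> conv (fun y => c * f y) (c * a).
  move=> hf e e0; have c0 : 0 < `|c| + 1 by rewrite ltr_wpDl.
  apply: filterS (hf _ (divr_gt0 e0 c0)) => y /= h.
  rewrite -mulrBr normrM; apply: le_lt_trans (_ : (`|c| + 1) * `|a - f y| < e).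
    by rewrite ler_wpM2r // lerDl.
  by rewrite mulrC -ltr_pdivlMr.
have conv_sum (J : Type) (r : seq J) (f : J -> bmat -> K) (a : J -> K) :
    (forall k, conv (f k) (a k)) -> conv (fun y => \sum_(k <- r) f k y) (\sum_(k <- r) a k).
  move=> h; elim: r => [|k r IH].
    move=> e e0; apply: filterE => y /=; by rewrite !big_nil subrr normr0.
  rewrite big_cons; have := convD _ _ _ _ (h k) IH; congr conv.
  by apply/funext => y; rewrite big_cons.
have form_conv Fs Gs x y : conv (fun T => form (ent T) Fs Gs x y) (form l Fs Gs x y).
  apply: (conv_sum) => i; apply: (conv_sum) => j.
  have := convZ (Num.conj (x i) * y j) _ _ (hl i j); rewrite mulrAC; congr conv.
  by apply/funext => T; rewrite mulrAC.
have formB (S T : I -> I -> K) Fs Gs x y :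
    form (fun i j => S i j - T i j) Fs Gs x y = form S Fs Gs x y - form T Fs Gs x y.
  rewrite /form -sumrB; apply: eq_bigr => i _; rewrite -sumrB; apply: eq_bigr => j _.
  by rewrite mulrBr mulrBl.
have near_l (e : K) x : 0 < e -> F [set y | `|x - y| < e] ->
    bounded_by (fun i j => l i j - ent x i j) e.
  move=> e0 Fx Fs Gs a b; apply: le_add_eps => [||d d0].
  - by rewrite mulr_ge0.
  - by apply: mulr_ge0; [exact: ltW|rewrite addr_ge0 // sqnorm_ge0].
  have d20 : 0 < d / 2 by rewrite divr_gt0.
  have [y [/= hy1 hy2]] := filter_ex (filterI (form_conv Fs Gs a b _ d20) Fx).
  rewrite formB -(subrK (form (ent y) Fs Gs a b) (form l Fs Gs a b)) -addrA.
  apply: le_trans (_ : 2 * (d / 2 + `|form (ent y) Fs Gs a b - form (ent x) Fs Gs a b|) <= _).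
    by rewrite ler_pM2l //; apply: le_trans (ler_normD _ _) _; rewrite lerD2r ltW.
  rewrite mulrDr mulrCA divff ?pnatr_eq0 // mulr1 lerD2l distrC -formB.
  rewrite -ent_subE; exact: bounded_by_le (ltW hy2) (bounded_norm (x - y)) Fs Gs a b.
have bl : bounded l.
  have [x Fx] := Fball 1 ltr01.
  have b1 : bounded (fun i j => l i j - ent x i j) by exists 1 => //; exact: near_l.
  have := bounded_comb 1 b1 (ent_bounded x).
  by congr bounded; apply/funext => i; apply/funext => j; rewrite mul1r subrK.
apply/cvg_ex; exists (BMat bl); apply/cvg_ballP => e e0.
have e20 : 0 < e / 2 by rewrite divr_gt0.
have [x Fx] := Fball _ e20; apply: filterS (Fx) => y hy.
rewrite -ball_normE /= -(subrK x (BMat bl)) -addrA (splitr e).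
apply: le_lt_trans (ler_normD _ _) _; rewrite ler_ltD //.
apply: bmat_norm_le; first exact: ltW.
by rewrite ent_subE; exact: near_l.
Qed.

HB.instance Definition _ := Uniform_isComplete.Build bmat complete.

(* The product estimate needs strictly positive bounds, hence |T| + 1. *)
Lemma bmat_bound (T : bmat) : bounded_by (ent T) (`|T| + 1).
Proof. by apply: bounded_by_le (bounded_norm T); rewrite lerDl. Qed.

Lemma bmat_bound_gt0 (T : bmat) : 0 < `|T| + 1.
Proof. by rewrite ltr_wpDl. Qed.

Lemma bounded_mulm (S T : bmat) : bounded (mulm (ent S) (ent T)).
Proof.
exists ((`|S| + 1) * (`|T| + 1)); first by rewrite mulr_ge0 ?ltW ?bmat_bound_gt0.
by apply: bounded_mul; rewrite ?bmat_bound_gt0 //; exact: bmat_bound.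
Qed.

Lemma bounded_adjm (T : bmat) : bounded (adjm (ent T)).
Proof. by exists `|T| => //; apply: bounded_adj; exact: bounded_norm. Qed.

Definition bmul S T := BMat (bounded_mulm S T).
Definition bstar T := BMat (bounded_adjm T).

Lemma bmulP (S T : bmat) i k : has_sum (fun j => ent S i j * ent T j k) (ent (bmul S T) i k).
Proof. by apply: mulmP (bounded_norm S) (bounded_norm T). Qed.

Lemma bmul_eq (S T U : bmat) :
  (forall i k, has_sum (fun j => ent S i j * ent T j k) (ent U i k)) -> bmul S T = U.
Proof. by move=> h; apply: bmat_eq => i k; apply: sumI_eq; exact: h. Qed.

(** In sum over i = phi j of conj(x_i) y_j every x_i and every y_j occurs at most once,
    so the inequality of the means gives the bound 1. *)
Lemma bounded_injection (phi : I -> I) : injective phi ->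
  bounded (fun i j : I => (i == phi j)%:R : K).
Proof.
move=> phi_inj; exists 1 => // F G x y; rewrite mul1r.
pose P := [seq ij <- [seq (i, j) | i <- F, j <- G] | ij.1 == phi ij.2].
have uP : uniq P.
  apply: filter_uniq; apply: allpairs_uniq; rewrite ?fset_uniq //.
  by move=> [? ?] [? ?] _ _ /= [-> ->].
have P_in ij : ij \in P -> [/\ ij.1 \in F, ij.2 \in G & ij.1 = phi ij.2].
  rewrite mem_filter => /andP[/eqP e /allpairsP[[i j] /= [iF jG eij]]].
  by move: e; rewrite eij.
have -> : form (fun i j : I => (i == phi j)%:R : K) F G x y =
    \sum_(ij <- P) Num.conj (x ij.1) * y ij.2.
  rewrite big_filter big_mkcond big_allpairs /=; apply: eq_bigr => i _.
  apply: eq_bigr => j _; case: eqP => _; first by rewrite mulr1.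
  by rewrite mulr0 mul0r.
apply: le_trans (_ : \sum_(ij <- P) (`|x ij.1| ^+ 2 + `|y ij.2| ^+ 2) <= _).
  rewrite -[2]gtr0_norm // -normrM mulr_sumr.
  apply: le_trans (ler_norm_sum _ _ _) _; apply: ler_sum => ij _.
  rewrite normrM gtr0_norm //; apply: le_trans (normM_le_squares _ _) _.
  by rewrite norm_conjC.
have sub_le (h : I -> K) (S : seq I) (H : {fset I}) : uniq S -> {subset S <= H} ->
    \sum_(i <- S) `|h i| ^+ 2 <= sqnorm H h.
  move=> uS SH; rewrite /sqnorm [leRHS](bigID (mem S)) /=.
  rewrite -[X in _ <= X + _]big_filter.
  rewrite [X in _ <= X + _](perm_big S); last first.
    apply: uniq_perm; rewrite ?filter_uniq ?fset_uniq // => i.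
    by rewrite mem_filter; apply: andb_idr; exact: SH.
  by rewrite lerDl sumr_ge0.
rewrite big_split /=; apply: lerD.
  rewrite -(big_map fst xpredT (fun i => `|x i| ^+ 2)); apply: sub_le.
    rewrite map_inj_in_uniq // => -[i j] [i' j'] /P_in[_ _ /= e] /P_in[_ _ /= e'] /= ii.
    by move: ii; rewrite e e' => /phi_inj ->.
  by move=> _ /mapP[ij /P_in[? _ _] ->].
rewrite -(big_map snd xpredT (fun i => `|y i| ^+ 2)); apply: sub_le.
  rewrite map_inj_in_uniq // => -[i j] [i' j'] /P_in[_ _ /= e] /P_in[_ _ /= e'] /= ii.
  by rewrite e e' ii.
by move=> _ /mapP[ij /P_in[_ ? _] ->].
Qed.

Definition injm phi (h : injective phi) : bmat := BMat (bounded_injection h).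

Definition bone : bmat := injm (@inj_id I).

Lemma bmul_injr phi (h : injective phi) (S : bmat) i k :
  ent (bmul S (injm h)) i k = ent S i (phi k).
Proof.
apply: sumI_eq; have := @has_sum1 R I (fun j => ent S i j * ent (injm h) j k) (phi k).
rewrite /= eqxx mulr1; apply=> j /negbTE jk.
by rewrite jk mulr0.
Qed.

Lemma bmul_star_injl phi (h : injective phi) (S : bmat) i k :
  ent (bmul (bstar (injm h)) S) i k = ent S (phi i) k.
Proof.
apply: sumI_eq; have := @has_sum1 R I (fun j => ent (bstar (injm h)) i j * ent S j k) (phi i).
rewrite /= /adjm /= eqxx conjC1 mul1r; apply=> j /negbTE ji.
by rewrite ji conjC0 mul0r.
Qed.

Lemma bmul1 T : bmul T bone = T.
Proof. by apply: bmat_eq => i j; rewrite bmul_injr. Qed.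

Lemma bstar1 : bstar bone = bone.
Proof.
apply: bmat_eq => i j; rewrite /= /adjm /= eq_sym.
by case: eqP => _; rewrite ?conjC1 ?conjC0.
Qed.

Lemma b1mul T : bmul bone T = T.
Proof. by rewrite -{1}bstar1; apply: bmat_eq => i j; rewrite bmul_star_injl. Qed.

Lemma bmulA : associative bmul.
Proof.
move=> S T U; apply: bmat_eq => i j; rewrite /=.
pose C := `|S| + `|T| + `|U| + 1 : K.
have C0 : 0 < C by rewrite ltr_wpDl // !addr_ge0.
have := @mulmA R I (ent S) (ent T) (ent U) C C0; move=> -> //.
- apply: bounded_by_le (bounded_norm S).
  by rewrite /C -!addrA lerDl !addr_ge0.
- apply: bounded_by_le (bounded_norm T).
  by rewrite /C [_ + `|T|]addrC -!addrA lerDl !addr_ge0.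
- apply: bounded_by_le (bounded_norm U).
  by rewrite /C addrAC lerDr !addr_ge0.
Qed.

Lemma bmulDl : left_distributive bmul +%R.
Proof.
move=> S T U; apply: bmul_eq => i k.
by apply: has_sum_ext (has_sumD (bmulP S U i k) (bmulP T U i k)) => j; rewrite mulrDl.
Qed.

Lemma bmulDr : right_distributive bmul +%R.
Proof.
move=> S T U; apply: bmul_eq => i k.
by apply: has_sum_ext (has_sumD (bmulP S T i k) (bmulP S U i k)) => j; rewrite mulrDr.
Qed.

Lemma bmulZl (a : K) S T : a *: bmul S T = bmul (a *: S) T.
Proof.
apply/esym/bmul_eq => i k.
by apply: has_sum_ext (has_sumZ a (bmulP S T i k)) => j; rewrite mulrA.
Qed.

Lemma bmulZr (a : K) S T : a *: bmul S T = bmul S (a *: T).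
Proof.
apply/esym/bmul_eq => i k.
by apply: has_sum_ext (has_sumZ a (bmulP S T i k)) => j; rewrite mulrCA.
Qed.

Lemma bstarK : involutive bstar.
Proof. by move=> T; apply: bmat_eq => i j; rewrite /= adjmK. Qed.

Lemma bstarD : {morph bstar : S T / S + T}.
Proof. by move=> S T; apply: bmat_eq => i j; rewrite /= /adjm /= rmorphD. Qed.

Lemma bstarZ (a : K) T : bstar (a *: T) = Num.conj a *: bstar T.
Proof. by apply: bmat_eq => i j; rewrite /= /adjm /= rmorphM. Qed.

Lemma bstarM S T : bstar (bmul S T) = bmul (bstar T) (bstar S).
Proof.
apply: bmat_eq => i j; rewrite /=.
by rewrite (adjmM (normr_ge0 S) (normr_ge0 T)) //; exact: bounded_norm.
Qed.

Lemma bstar_norm_le T : `|bstar T| <= `|T|.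
Proof. by apply: bmat_norm_le => //; apply: bounded_adj; exact: bounded_norm. Qed.

Lemma bmul_norm S T : `|bmul S T| <= `|S| * `|T|.
Proof.
have [->|S0] := eqVneq S 0.
  by have := bmulZl 0 0 T; rewrite !scale0r => <-; rewrite !normr0 mul0r.
have [->|T0] := eqVneq T 0.
  by have := bmulZr 0 S 0; rewrite !scale0r => <-; rewrite !normr0 mulr0.
apply: bmat_norm_le; first by rewrite mulr_ge0.
by apply: bounded_mul; rewrite ?normr_gt0 //; exact: bounded_norm.
Qed.

Lemma bmul_cstar T : `|bmul (bstar T) T| = `|T| ^+ 2.
Proof.
apply/le_anti/andP; split.
  apply: le_trans (bmul_norm _ _) _; rewrite expr2 ler_wpM2r //.
  exact: bstar_norm_le.
apply: le_add_eps => [||e e0]; first by rewrite exprn_ge0.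
  exact: normr_ge0.
set q := `|bmul _ _|; have q0 : 0 < e + q by rewrite ltr_wpDr // normr_ge0.
rewrite -(sqrtCK (e + q)) ler_sqr ?nnegrE ?sqrtC_ge0 ?normr_ge0 //; last exact: ltW.
apply: bmat_norm_le; first by rewrite sqrtC_ge0 ltW.
apply: (bounded_sqrt (C := `|T|)) => //; first exact: bounded_norm.
  by rewrite sqrtC_gt0.
rewrite sqrtCK; apply: (bounded_by_le (C := q)); first by rewrite lerDr ltW.
exact: (bounded_norm (bmul (bstar T) T)).
Qed.

Definition matrix_cstar : cstarAlgType R :=
  @CStarAlgType R (bmat : completeNormedModType K) bone bmul bstar
    bmulA b1mul bmul1 bmulDl bmulDr bmulZl bmulZr bstarK bstarD bstarZ bstarM
    bmul_norm bmul_cstar.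

Lemma matrix_cstar_one_neq0 (i : I) : (1 : matrix_cstar) != 0.
Proof.
apply/eqP => /(congr1 (fun T : bmat => ent T i i)) /eqP.
by rewrite /= eqxx oner_eq0.
Qed.
End MatrixAlgebra.

(** * Translations and dilations on the square-summable sequences *)

Section Model.
Variables (R : realType) (D : idomainType).
Hypothesis D_finite_quotients :
  forall m : D, m != 0 -> finite_set (residue_classes m).
Local Notation K := R[i].
Local Notation B := (matrix_cstar R D).

Let shift (n : D) : injective (fun j : D => n + j). Proof. exact: addrI. Qed.

(* The exceptional case makes the map injective for m = 0, too. *)
Let dilate (m : D) : injective (fun j : D => if m == 0 then j else m * j).
Proof. by move=> x y; case: eqVneq => // m0 /(mulfI m0). Qed.

Definition isom phi (h : injective phi) : B := injm R h.
Definition model_s (m : D) : B := isom (@dilate m).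
Definition model_u (n : D) : B := isom (@shift n).

Lemma injm_mul phi psi (h : injective phi) (h' : injective psi) i k :
  ent (isom h * isom h') i k = (i == phi (psi k))%:R.
Proof. exact: bmul_injr. Qed.

Lemma injm_isometry phi (h : injective phi) : star (isom h) * isom h = 1.
Proof.
apply: bmat_eq => i k; rewrite [LHS](bmul_star_injl h (injm R h)) /=.
by rewrite (inj_eq h).
Qed.

Lemma injm_range phi (h : injective phi) i k :
  ent (isom h * star (isom h)) i k = ((i == k) && `[< exists j, i = phi j >])%:R.
Proof.
have [[j ->]|nj] := pselect (exists j, i = phi j).
  have := @has_sum1 R D (fun j' => ent (injm R h) (phi j) j' * ent (bstar (injm R h)) j' k) j.
  rewrite /= eqxx mul1r => hs; rewrite [LHS](sumI_eq (hs _)).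
    rewrite /adjm /= eq_sym asboolT ?andbT; last by exists j.
    by case: eqP => _; rewrite ?conjC1 ?conjC0.
  by move=> j' jj; rewrite (inj_eq h) eq_sym (negbTE jj) mul0r.
rewrite asboolF // andbF; apply: sumI_eq.
apply: has_sum_ext (@has_sum1 R D (fun=> 0) i _) => // j' /=.
by case: eqP => [e|_]; rewrite ?mul0r //; case: nj; exists j'.
Qed.

(** For the last relation, u^c s_m is the isometry of the map j -> c + m j, whose range
    projection is diagonal and selects the coset of c; the cosets partition D. *)
Lemma model_relations : ring_cstar_relations model_s model_u.
Proof.
have star_u n : star (model_u n) = model_u (- n).
  apply: bmat_eq => i j; rewrite /= /adjm /=.
  rewrite (_ : (j == n + i) = (i == - n + j)); last first.
    by apply/eqP/eqP => ->; rewrite ?addKr ?addNKr.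
  by case: eqP => _; rewrite ?conjC1 ?conjC0.
have u_add l n : model_u l * model_u n = model_u (l + n).
  by apply: bmat_eq => i j; rewrite injm_mul /= addrA.
have u_zero : model_u 0 = 1.
  by apply: bmat_eq => i j; rewrite /= add0r.
split => //.
- by move=> m _; exact: injm_isometry.
- by move=> n; exact: injm_isometry.
- by move=> n; rewrite star_u u_add subrr.
- move=> k m k0 m0; apply: bmat_eq => i j; rewrite injm_mul /=.
  by rewrite (negbTE k0) (negbTE m0) (negbTE (mulf_neq0 k0 m0)) mulrA.
- move=> m n m0; apply: bmat_eq => i j; rewrite !injm_mul /= (negbTE m0).
  by rewrite mulrDr.
move=> m m0; rewrite fsbig_finite /=; last exact: D_finite_quotients.
have inj_c (c : D) : injective (fun j : D => c + m * j).
  by move=> x y /addrI /(mulfI m0).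
transitivity (\sum_(c <- fset_set (residue_classes m))
    (isom (inj_c (xget 0 c)) * star (isom (inj_c (xget 0 c))))).
  apply: eq_bigr => c _; rewrite /range_proj !mulrA -mulrA -starM.
  have -> : model_u (xget 0 c) * model_s m = isom (inj_c (xget 0 c)).
    by apply: bmat_eq => i j; rewrite injm_mul /= (negbTE m0).
  by [].
apply: bmat_eq => i k; rewrite ent_sum.
under eq_bigr do rewrite injm_range.
have [<-|ik] := eqVneq i k; last first.
  by rewrite big1 // /= (negbTE ik).
rewrite /= eqxx.
have i_in : coset_ideal m i \in fset_set (residue_classes m).
  by rewrite in_fset_set ?mem_set //; [exists i|exact: D_finite_quotients].
rewrite (big_fsetD1 _ i_in) /= asboolT.
  rewrite big_seq big1 ?addr0 // => c; rewrite in_fsetD1 => /andP[ci].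
  rewrite in_fset_set; last exact: D_finite_quotients.
  move=> /set_mem[n _ en]; rewrite asboolF // => -[j ij].
  move/eqP: ci; apply; rewrite -en ij -en.
  have [z ->] := coset_repr m n.
  by rewrite !coset_eq.
have [z ez] := coset_repr m i; exists (- z).
by rewrite ez mulrN addrK.
Qed.
End Model.

(** * Conclusion *)

Lemma universal_one_neq0 (R : realType) (D : idomainType)
    (D_finite_quotients : forall m : D, m != 0 -> finite_set (residue_classes m))
    (A : cstarAlgType R) (s u : D -> A) :
  is_universal_ring_cstar s u -> (1 : A) != 0.
Proof.
move=> [_ univ].
have [f [[fD _ _ f1 _] _ _] _] := univ _ _ _ (model_relations R D_finite_quotients).
apply: contra_neq (matrix_cstar_one_neq0 R (0 : D)) => one0.
by apply: (addrI (f 0)); rewrite -f1 one0 -fD !addr0.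
Qed.

Lemma simple_of_invertible (R : realType) (A : cstarAlgType R) : (1 : A) != 0 ->
  (forall x : A, x != 0 -> exists a b, a * x * b = 1) -> is_simple A.
Proof.
move=> one0 inv; split=> // J [_ J0 _ _ JM].
have [[x [Jx x0]]|nx] := pselect (exists x, J x /\ x != 0).
  right; apply/seteqP; split=> // y _; have [a [b axb]] := inv x x0.
  rewrite -(mulr1 y) -axb; apply: (proj1 (JM _ _ _)).
  by apply: (proj2 (JM _ _ _)); apply: (proj1 (JM _ _ _)).
left; apply/seteqP; split=> [x Jx|x ->] //=.
by apply: contrapT => /eqP x0; apply: nx; exists x.
Qed.

Local Close Scope complex_scope.
Theorem theorem1 (R : realType) (D : idomainType)
    (D_not_field : ~ GRing.field_axiom D)
    (D_finite_quotients :
      forall m : D, m != 0 -> finite_set (residue_classes m))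
    (A : cstarAlgType R) (s u : D -> A)
    (A_universal : is_universal_ring_cstar s u) :
  is_simple_purely_infinite A.
Proof.
have inv (x : A) : x != 0 -> exists a b, a * x * b = 1.
  apply: (approximable_invertible D_not_field D_finite_quotients (proj1 A_universal)).
  exact: (universal_generated D_finite_quotients (proj1 A_universal) A_universal).
split => //; apply: simple_of_invertible => //.
exact: universal_one_neq0 A_universal.
Qed.
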